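(* Let $\tilde g_{\tau,r}^\delta$ be the exponential-type quasi-boundary value regularized solution. (i) Case $r\le0$. Assume that the exact source satisfies $g\in D((-L)^p)$ for some $p>0$. Then $$\|\tilde g_{\tau,r}^{\delta}-g\|\le\begin{cases} C\left(1+\|g\|_{D((-L)^p)}\right)\delta^{\frac12}, & p\ge1,\ \tau=\delta^{\frac12},\\ C\left(1+\|g\|_{D((-L)^p)}\right)\delta^{\frac{p}{p+1}}, & 0<p<1,\ \tau=\delta^{\frac{1}{p+1}}.\end{cases}$$ (ii) Case $r>0$. Assume that $g\in D\left(\exp\left(\frac{(-L)^r}{2}\right)\right)$. Then, by choosing $\tau=\delta^{\frac{(p+1)(1+r)}{p+r+2}}$, we obtain $$\|\tilde g_{\tau,r}^{\delta}-g\|\le C\left(1+\|g\|_{r,\mathrm{exp}}\right)\delta^{\frac{1+r}{p+r+2}},$$ where $p>1$ is an arbitrary constant. Here $C>0$ denotes a generic constant depending only on $\alpha,\beta,l$ and the operator $L$, but independent of $\delta$, $\tau$ and $g$.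
   Context: Fix $\alpha\in(0,1]$, $\beta\ge 0$, $l>0$, and a bounded connected domain $\Omega\subset\mathbb{R}^N$ ($N\ge1$) with smooth boundary. $(\cdot,\cdot)$ and $\|\cdot\|$ are the inner product and norm of $L^2(\Omega)$. $-L:H^2(\Omega)\cap H_0^1(\Omega)\to L^2(\Omega)$ is a symmetric uniformly elliptic operator with eigenpairs $-L\varphi_k=\lambda_k\varphi_k$, $0<\lambda_1\le\lambda_2\le\cdots\to\infty$, where $\{\varphi_k\}_{k\ge1}$ is a complete orthonormal basis of $L^2(\Omega)$. $\|\psi\|_{D((-L)^s)}=(\sum_k\lambda_k^{2s}|(\psi,\varphi_k)|^2)^{1/2}$ and $\|\psi\|_{r,\mathrm{exp}}=(\sum_k\exp(\lambda_k^r)|(\psi,\varphi_k)|^2)^{1/2}$; $D((-L)^s)$ and $D(\exp(\frac{(-L)^r}{2}))$ are the subspaces of $L^2(\Omega)$ where these norms are finite. Kilbas–Saigo function: $E_{\alpha,m,n}(z)=1+\sum_{k=1}^\infty\prod_{j=0}^{k-1}\frac{\Gamma(\alpha(jm+n)+1)}{\Gamma(\alpha(jm+n+1)+1)}z^k$ ($\alpha,m>0$, $n>-1/\alpha$). Put $\eta_2=\frac{\Gamma(1+\beta)}{\Gamma(1+\alpha+\beta)}$ and $$\sigma_k=\frac{\eta_2}{\sqrt{\lambda_k}}\,l^{\alpha+\beta}E_{\alpha,1+\frac{\beta}{\alpha},1+\frac{2\beta}{\alpha}}\left(-\sqrt{\lambda_k}\,l^{\alpha+\beta}\right),\qquad Kg=\sum_{k=1}^\infty\sigma_k(g,\varphi_k)\varphi_k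 .$$ Let $f$ be the known boundary datum and $F=\sum_k(f,\varphi_k)E_{\alpha,1+\frac{\beta}{\alpha},\frac{\beta}{\alpha}}(-\sqrt{\lambda_k}\,l^{\alpha+\beta})\varphi_k$. The exact source $g$ produces the exact trace $h=F-Kg$ at $x=l$ (i.e. $h=u(l,\cdot)$ for the underlying fractional elliptic boundary value problem); set $\hat h=F-h=Kg$. The noisy trace $h^\delta\in L^2(\Omega)$ satisfies $\|h^\delta-h\|\le\delta$, $\delta>0$, and $\hat h^\delta=F-h^\delta$, so $\|\hat h^\delta-\hat h\|\le\delta$. For $\tau>0$, $r\in\mathbb{R}$, the exponential-type quasi-boundary value regularized solution is $$\tilde g_{\tau,r}^\delta=\sum_{k=1}^\infty\frac{1}{\sigma_k+\tau\exp(\lambda_k^r)}(\hat h^\delta,\varphi_k)\varphi_k ,$$ i.e. the solution of $K\tilde g+\tau\exp((-L)^r)\tilde g=\hat h^\delta$, where $\exp((-L)^r)\varphi_k=\exp(\lambda_k^r)\varphi_k$.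
   Formalization: The constant C may also depend on the fixed parameters r and p; a C depending only on α, β, l and L is impossible (e.g. in (ii), g=exp(-λ_k^r/2)φ_k with p→1 forces C to be unbounded). *)

(* Defs.v *)
From HB Require Import structures.
From mathcomp Require Import all_boot all_order all_algebra.
From mathcomp Require Import all_classical all_reals all_analysis.

Set Implicit Arguments.
Unset Strict Implicit.
Unset Printing Implicit Defensive.
Import Order.TTheory GRing.Theory Num.Theory.
Import numFieldNormedType.Exports.
Local Open Scope classical_set_scope.
Local Open Scope ring_scope.

(* The Euclidean space R^N, N >= 1, is 'rV[R]_n.+1 with N = n.+1. *)

Section lebesgue.
Variables (R : realType) (n : nat).
Local Notation V := 'rV[R]_n.+1.

(* The half-open box with lower corner c.1 and upper corner c.2; it is empty,
   and has volume 0, as soon as some c.2 i <= c.1 i. *)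
Definition box (c : V * V) : set V :=
  [set x | forall i, c.1 ord0 i <= x ord0 i < c.2 ord0 i].

Definition box_volume (c : V * V) : R :=
  \prod_i Num.max 0 (c.2 ord0 i - c.1 ord0 i).

Definition box_cover (A : set V) : set (nat -> V * V) :=
  [set c | A `<=` \bigcup_k box (c k)].

Definition lebesgue_outer (A : set V) : \bar R :=
  ereal_inf [set \sum_(k <oo) (box_volume (c k))%:E | c in box_cover A]%E.

Lemma box_volume_ge0 c : 0 <= box_volume c.
Proof. by apply: prodr_ge0 => i _; rewrite le_max lexx. Qed.

Let vol_ge0 c : (0 <= (box_volume c)%:E)%E.
Proof. by rewrite lee_fin box_volume_ge0. Qed.

Lemma lebesgue_outer_ge0 A : (0 <= lebesgue_outer A)%E.
Proof.
by apply: le_ereal_inf_tmp => _ [c _ <-]; apply: nneseries_ge0.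
Qed.

Lemma lebesgue_outer0 : lebesgue_outer set0 = 0%E.
Proof.
apply/eqP; rewrite eq_le lebesgue_outer_ge0 andbT.
apply: ereal_inf_lbound; exists (fun=> (0, 0)); first by move=> ? [].
rewrite eseries0// => k _ _; rewrite /box_volume/=.
by rewrite (bigD1 ord0)//= subrr maxxx mul0r.
Qed.

Lemma le_lebesgue_outer :
  {homo lebesgue_outer : A B / A `<=` B >-> (A <= B)%E}.
Proof.
move=> A B AB; apply/ereal_inf_le_tmp => x [c Bc <-].
by exists c => //; apply: subset_trans Bc.
Qed.

Lemma lebesgue_outer_sigma_subadditive : sigma_subadditive lebesgue_outer.
Proof.
move=> A; have [[i ioo]|] := pselect (exists i, lebesgue_outer (A i) = +oo%E).
  rewrite (eseries_pinfty _ _ ioo) ?leey// => k _.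
  by rewrite -ltNye (lt_le_trans _ (lebesgue_outer_ge0 _)).
rewrite -forallNE => Aoo.
suff add2e (e : {posnum R}) : (lebesgue_outer (\bigcup_n A n) <=
    \sum_(i <oo) lebesgue_outer (A i) + e%:num%:E)%E.
  by apply/lee_addgt0Pr => _/posnumP[].
apply: (le_trans _ (epsilon_trick _ _ _)) => //; last first.
  by move=> k; exact: lebesgue_outer_ge0.
pose P k (c : nat -> V * V) := box_cover (A k) c /\
  (\sum_(j <oo) (box_volume (c j))%:E <=
   lebesgue_outer (A k) + (e%:num / (2 ^ k.+1)%:R)%:E)%E.
have [G PG] : {G : nat -> nat -> V * V & forall k, P k (G k)}.
  apply: (@choice _ _ P) => k; rewrite /P /lebesgue_outer.
  set S := (X in ereal_inf X); move infS : (ereal_inf S) => iS.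
  case: iS infS => [r Sr|Soo|Soo].
  - have en1 : (0 < e%:num / (2 ^ k.+1)%:R)%R by [].
    have /(lb_ereal_inf_adherent en1) : ereal_inf S \is a fin_num by rewrite Sr.
    move=> [x [c Akc volcx] xS].
    by exists c; split => //; rewrite volcx -Sr; exact/ltW.
  - by have := Aoo k; rewrite /lebesgue_outer Soo.
  - suff : lbound S 0%E by move/le_ereal_inf_tmp; rewrite Soo.
    by move=> /= _ [c _ <-]; exact: nneseries_ge0.
pose vol (c : V * V) := (box_volume c)%:E.
have volG_ge0 x : (0 <= (vol \o uncurry G) x)%E by exact: vol_ge0.
apply: (@le_trans _ _ (\esum_(i in setT) (vol \o uncurry G) i)%E).
  rewrite /lebesgue_outer; apply: ereal_inf_lbound => /=.
  have /card_esym/ppcard_eqP[f] := card_nat2.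
  exists (uncurry G \o f).
    apply: (@subset_trans _ (\bigcup_n \bigcup_k box (G n k))) => [t [i _]|].
      by move=> /(PG i).1 [j _ ?]; exists i => //; exists j.
    move=> t [i _ [j _ Bijt]]; exists (f^-1%FUN (i, j)) => //=.
    by rewrite invK ?inE.
  rewrite -(esum_pred_image (vol \o uncurry G) _ xpredT) ?[fun=> _]set_true//.
  by rewrite image_eq.
rewrite (_ : esum _ _ = \sum_(i <oo) \sum_(j <oo) vol (G i j))%E; last first.
  pose J : nat -> set (nat * nat) := fun i => [set (i, j) | j in setT].
  rewrite (_ : setT = \bigcup_k J k); last first.
    by rewrite predeqE => -[a b]; split => // _; exists a => //; exists b.
  rewrite esum_bigcupT /=; last 2 first.
    - apply/trivIsetP => i j _ _ ij.
      rewrite predeqE => -[k m] /=; split => //= -[] [_] _ [<-{k} _].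
      by move=> [m' _] [] /esym/eqP; rewrite (negbTE ij).
    - by move=> /= [k m]; apply: vol_ge0.
  rewrite -(image_id [set: nat]) -fun_true esum_pred_image//; last first.
    by move=> k _; apply: esum_ge0 => ? _; exact: vol_ge0.
  apply: eq_eseriesr => /= j _.
  rewrite -(esum_pred_image (vol \o uncurry G) (pair j) predT)/=.
  - by congr esum; rewrite predeqE => -[a b]; split; move=> [i _ <-]; exists i.
  - by move=> ? _; exact: vol_ge0.
  - by move=> ? ? _ _; exact: (@can_inj _ _ _ snd).
apply: lee_lim.
- apply: is_cvg_nneseries => k *.
  by apply: nneseries_ge0 => m *; exact: (volG_ge0 (k, m)).
- by apply: is_cvg_nneseries => k *; apply: adde_ge0 => //;
    exact: lebesgue_outer_ge0.
- by near=> k; apply: lee_sum => i _; exact: (PG i).2.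
Unshelve. all: by end_near. Qed.

HB.instance Definition _ := isOuterMeasure.Build R V lebesgue_outer
  lebesgue_outer0 lebesgue_outer_ge0 le_lebesgue_outer
  lebesgue_outer_sigma_subadditive.

Let outer : {outer_measure set V -> \bar R} := lebesgue_outer.

(* R^N with the sigma-algebra of Lebesgue (i.e. Caratheodory) measurable
   sets. *)
Definition Leb : Type := caratheodory_type outer.

HB.instance Definition _ := Measurable.on Leb.

Definition leb : {measure set Leb -> \bar R} :=
  (outer : set (caratheodory_type outer) -> \bar R).

End lebesgue.
Arguments leb {R n}.

Section sobolev.
Variables (R : realType) (n : nat).
Local Notation V := 'rV[R]_n.+1.
Implicit Types (Om : set V) (u v : V -> R) (i j : 'I_n.+1).

Definition pderiv i u : V -> R := fun x => 'D_(delta_mx ord0 i) u x.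

Fixpoint Ck (k : nat) u : Prop :=
  continuous u /\
  if k is k'.+1 then
    forall i, (forall x : V, derivable u x (delta_mx ord0 i)) /\
              Ck k' (pderiv i u)
  else True.

Definition smooth u := forall k, Ck k u.

(* Near each boundary point Om is the sublevel set {rho < 0} of a smooth
   function whose gradient does not vanish at that point. *)
Definition smooth_boundary Om := forall x, (closure Om `\` Om) x ->
  exists (rho : V -> R) (U : set V),
    [/\ smooth rho, nbhs x U, (exists i, pderiv i rho x != 0) &
        forall y, U y -> (Om y <-> rho y < 0)].

Definition bounded_smooth_domain Om :=
  [/\ open Om, connected Om, Om !=set0, bounded_set Om & smooth_boundary Om].

(* L^2(Om): functions are representatives, and only their values on Om
   matter. *)
Definition L2 Om u :=
  measurable_fun (Om : set (Leb R n)) (u : Leb R n -> R) /\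
  (\int[leb]_(x in Om) ((u x) ^+ 2)%:E < +oo)%E.

Definition L2_inner Om u v : R := \int[leb]_(x in Om) (u x * v x).

Definition L2_norm Om u : R := Num.sqrt (L2_inner Om u u).

Definition eq_ae Om u v := {ae leb, forall x : Leb R n, Om x -> u x = v x}.

Definition test_function Om u :=
  [/\ smooth u, compact (closure [set x | u x != 0]) &
      closure [set x | u x != 0] `<=` Om].

(* v is the i-th weak partial derivative of u in Om. *)
Definition weak_pderiv Om i u v := forall psi, test_function Om psi ->
  L2_inner Om u (pderiv i psi) = - L2_inner Om v psi.

(* u is in H^1_0(Om), the H^1-closure of the test functions. *)
Definition H10 Om u := L2 Om u /\ exists du : 'I_n.+1 -> V -> R,
  (forall i, L2 Om (du i) /\ weak_pderiv Om i u (du i)) /\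
  exists psi : nat -> V -> R,
    [/\ forall k, test_function Om (psi k),
        L2_norm Om (psi k \- u) @[k --> \oo] --> 0 &
        forall i, L2_norm Om (pderiv i (psi k) \- du i) @[k --> \oo] --> 0].

(* u is in H^2(Om), with gradient du and Hessian ddu. *)
Definition H2_derivs Om u (du : 'I_n.+1 -> V -> R)
    (ddu : 'I_n.+1 -> 'I_n.+1 -> V -> R) :=
  [/\ L2 Om u,
      forall i, L2 Om (du i) /\ weak_pderiv Om i u (du i) &
      forall i j, L2 Om (ddu i j) /\ weak_pderiv Om j (du i) (ddu i j)].

Definition H2_H10 Om u := (exists du ddu, H2_derivs Om u du ddu) /\ H10 Om u.

Definition bounded_coef Om u :=
  measurable_fun (Om : set (Leb R n)) (u : Leb R n -> R) /\
  exists M : R, forall x, Om x -> `|u x| <= M.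

(* L : H^2(Om) /\ H^1_0(Om) -> L^2(Om), a second-order operator
   L u = sum_ij a_ij d_ij u + sum_i b_i d_i u + c u that is uniformly elliptic
   and symmetric for the L^2 inner product.  Divergence form
   sum_ij d_i (a_ij d_j u) + c u with a_ij Lipschitz and a_ij = a_ji is the
   case b_j = sum_i d_i a_ij.  Positivity of -L is not part of this
   definition: it is expressed by the spectrum, in [eigensystem]. *)
Definition symmetric_uniformly_elliptic Om (L : (V -> R) -> (V -> R)) :=
  [/\ (exists (a : 'I_n.+1 -> 'I_n.+1 -> V -> R) (b : 'I_n.+1 -> V -> R)
             (c : V -> R),
        [/\ [/\ forall i j, bounded_coef Om (a i j),
                forall i, bounded_coef Om (b i) & bounded_coef Om c],
            forall i j x, Om x -> a i j x = a j i x,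
            (exists2 theta : R, 0 < theta & forall x (xi : V), Om x ->
               theta * (\sum_i xi ord0 i ^+ 2) <=
               \sum_i \sum_j a i j x * xi ord0 i * xi ord0 j) &
            forall u du ddu, H2_H10 Om u -> H2_derivs Om u du ddu ->
              eq_ae Om (L u) (fun x => \sum_i \sum_j a i j x * ddu i j x +
                                       \sum_i b i x * du i x + c x * u x)]),
      forall u, H2_H10 Om u -> L2 Om (L u) &
      forall u v, H2_H10 Om u -> H2_H10 Om v ->
        L2_inner Om (L u) v = L2_inner Om u (L v)].

(* v = \sum_k m_k (u, phi_k) phi_k, with convergence in L^2(Om). *)
Definition spectral_sum Om (phi : nat -> V -> R) (m : nat -> R) u v :=
  L2 Om v /\
  L2_norm Om (fun x => v x -
    \sum_(k < N) m k * L2_inner Om u (phi k) * phi k x) @[N --> \oo] --> 0.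

(* Indices start at 0: lam k and phi k are the (k+1)-st eigenvalue and
   eigenfunction of - L. *)
Definition eigensystem Om (L : (V -> R) -> (V -> R)) (lam : nat -> R)
    (phi : nat -> V -> R) :=
  [/\ [/\ 0 < lam 0%N, {homo lam : k k' / (k <= k')%N >-> k <= k'} &
          lam k @[k --> \oo] --> +oo%R],
      forall k, H2_H10 Om (phi k) /\
        eq_ae Om (fun x => - L (phi k) x) (fun x => lam k * phi k x),
      forall k k', L2_inner Om (phi k) (phi k') = (k == k')%:R &
      forall u, L2 Om u -> spectral_sum Om phi (fun=> 1) u u].

(* The subspace of L^2(Om) cut out by, and the norm given by, the weighted
   sum \sum_k w_k |(u, phi_k)|^2. *)
Definition weighted_series Om (phi : nat -> V -> R) (w : nat -> R) u :=
  series (fun k => w k * `|L2_inner Om u (phi k)| ^+ 2).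

Definition weighted_dom Om phi w u :=
  L2 Om u /\ cvgn (weighted_series Om phi w u).

Definition weighted_norm Om phi w u : R :=
  Num.sqrt (limn (weighted_series Om phi w u)).

Definition frac_weight (lam : nat -> R) (s : R) k := lam k `^ (2 * s).
Definition exp_weight (lam : nat -> R) (r : R) k := expR (lam k `^ r).

(* D((-L)^s) *)
Definition frac_dom Om lam phi s := weighted_dom Om phi (frac_weight lam s).
Definition frac_norm Om lam phi s := weighted_norm Om phi (frac_weight lam s).

(* D(exp((-L)^r / 2)) *)
Definition exp_dom Om lam phi r := weighted_dom Om phi (exp_weight lam r).
Definition exp_norm Om lam phi r := weighted_norm Om phi (exp_weight lam r).

End sobolev.

Section kilbas_saigo.
Variable R : realType.

(* Euler's Gamma function, for x > 0. *)
Definition Gamma (x : R) : R :=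
  \int[lebesgue_measure]_(t in `]0, +oo[) (t `^ (x - 1) * expR (- t)).

Definition kilbas_saigo (alpha m q z : R) : R :=
  1 + limn (fun N : nat => \sum_(1 <= k < N)
    (\prod_(0 <= j < k) (Gamma (alpha * (j%:R * m + q) + 1) /
                         Gamma (alpha * (j%:R * m + q + 1) + 1))) * z ^+ k).

Definition eta2 (alpha beta : R) : R :=
  Gamma (1 + beta) / Gamma (1 + alpha + beta).

Definition sigma (alpha beta l : R) (lam : nat -> R) (k : nat) : R :=
  eta2 alpha beta / Num.sqrt (lam k) * l `^ (alpha + beta) *
  kilbas_saigo alpha (1 + beta / alpha) (1 + 2 * beta / alpha)
    (- (Num.sqrt (lam k) * l `^ (alpha + beta))).

Definition boundary_factor (alpha beta l : R) (lam : nat -> R) (k : nat) : R :=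
  kilbas_saigo alpha (1 + beta / alpha) (beta / alpha)
    (- (Num.sqrt (lam k) * l `^ (alpha + beta))).

End kilbas_saigo.

Section inverse_source.
Variables (R : realType) (n : nat).
Local Notation V := 'rV[R]_n.+1.
Variables (Om : set V) (lam : nat -> R) (phi : nat -> V -> R).
Variables (alpha beta l : R).

(* hd is a noisy measurement, at level delta, of the exact trace h = F - K g
   produced by the source g and the boundary datum f. *)
Definition noisy_trace (f g F Kg hd : V -> R) (delta : R) :=
  [/\ L2 Om f /\ L2 Om g,
      spectral_sum Om phi (boundary_factor alpha beta l lam) f F,
      spectral_sum Om phi (sigma alpha beta l lam) g Kg,
      L2 Om hd &
      L2_norm Om (hd \- (F \- Kg)) <= delta].

Definition exp_qbv_solution (tau r : R) (hhat gt : V -> R) :=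
  spectral_sum Om phi
    (fun k => (sigma alpha beta l lam k + tau * expR (lam k `^ r))^-1) hhat gt.

End inverse_source.

(* Main.v *)
Require Import Defs.
From mathcomp Require Import all_boot all_order all_algebra.
From mathcomp Require Import all_classical all_reals all_analysis.
From mathcomp Require Import measurable_realfun.
From mathcomp Require Import ring lra.

Set Implicit Arguments.
Unset Strict Implicit.
Unset Printing Implicit Defensive.
Import Order.TTheory GRing.Theory Num.Theory.
Import numFieldNormedType.Exports.
Local Open Scope classical_set_scope.
Local Open Scope ring_scope.

(* The only fact needed about the Kilbas-Saigo function is [sigma_k >= c /
   lambda_k] for some c > 0.  Put y(z) = E_(alpha, m, m-1)(- z) with
   m = 1 + beta / alpha, so that y(z) = \sum_k (- z)^k / (Phi 1 ... Phi k) with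
   Phi k = Gamma(x + 1) / Gamma(x + 1 - alpha) at x = (alpha + beta) k.
   Comparing power series, lambda_k sigma_k = 1 - y(z) at
   z = sqrt(lambda_k) l^(alpha + beta), so it suffices that y is nonincreasing
   and y(z) < 1 for small z > 0.

   By Euler's product, Phi k is the limit of n^alpha \prod_(i <= n)
   (1 - alpha / (x + i)), whose partial fraction expansion is 1 minus a sum of
   nonnegative multiples of the resolvents 1 / (x + i).  Hence the operator
   z^k |-> Phi k z^k (k >= 1), which is the Caputo derivative in disguise,
   satisfies the minimum principle: at a minimum point over [0, z] its value
   is <= 0.  This operator maps the truncations of y to - z times
   the previous ones, so that the minimum principle, applied to truncations of
   y(z) and of y(a z) - y(z), bounds both below by quantities that tend to 0.

   With this lower bound, weighted AM-GM in the form
   c / lambda + tau e >= (c / lambda)^a (tau e)^(1 - a) bounds the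
   filter 1 / (sigma + tau e) and its residual, and orthonormality of the
   eigenfunctions turns these bounds into the rates. *)

(** * Multipliers of coefficients and the minimum principle *)

Section coefficient_multipliers.
Variable R : realType.
Implicit Types (p : {poly R}) (w : nat -> R).

Definition multp w p : {poly R} := \poly_(k < size p) (w k * p`_k).

Lemma coef_multp w p k : (multp w p)`_k = w k * p`_k.
Proof.
by rewrite coef_poly; case: ltnP => // /(nth_default 0) ->; rewrite mulr0.
Qed.

Lemma poly_min p (z : R) : 0 <= z ->
  exists2 c, 0 <= c <= z & forall s, 0 <= s <= z -> p.[c] <= p.[s].
Proof.
move=> z0; have cp : {within `[0, z], continuous (horner p)}.
  by apply: continuous_subspaceT => x; exact: continuous_horner.
have [c c0z cmin] := EVT_min z0 cp.
by exists c => // s sz; apply: cmin; rewrite in_itv.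
Qed.

(** Dividing [p - p(c)] by [X - c] gives a quotient [w] with [w(c) = p'(c)]. Were it positive, [w]
    would be positive slightly left of [c], and [p] would drop below [p(c)] there. *)
Lemma deriv_le0_at_left_min p (c : R) : 0 < c ->
  (forall s, 0 <= s <= c -> p.[c] <= p.[s]) -> p^`().[c] <= 0.
Proof.
move=> c0 cmin; have : root (p - p.[c]%:P) c by rewrite rootE !hornerE subrr.
move=> /factor_theorem[w wE].
have -> : p^`() = (p - p.[c]%:P)^`() by rewrite derivB derivC subr0.
rewrite wE derivM derivB derivX derivC subr0 mulr1 !hornerE subrr mulr0 add0r.
rewrite leNgt; apply/negP => wc.
have /= /cvgrPdist_lt/(_ _ wc) := continuous_horner (p := w) (x := c).
move=> /nbhs_ballP[e /= e0 we].
pose s := Num.max 0 (c - e / 2).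
have sc : s < c by rewrite gt_max c0/= ltrBlDr ltrDl divr_gt0.
have s0 : 0 <= s by rewrite le_max lexx.
have ws : 0 < w.[s].
  have /we/= : ball c e s.
    rewrite /ball/= gtr0_norm ?subr_gt0// ltrBlDr -ltrBlDl lt_max.
    by apply/orP; right; rewrite ltrD2l ltrN2 ltr_pdivrMr// ltr_pMr// ltr1n.
  by rewrite ltr_norml => /andP[_]; rewrite ltrBlDr -ltrBlDl subrr.
have := congr1 (horner^~ s) wE; rewrite !hornerE => wsE.
have := cmin s; rewrite s0 ltW// => /(_ isT).
by rewrite -subr_ge0 wsE pmulr_rge0// subr_ge0 leNgt sc.
Qed.

(* At a minimum point [c] of [q = \sum_k p_k X^k / (g k + i)], the identity
   [g X q' + i q = p] gives [i q(c) >= p(c)]. *)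
Lemma multp_resolvent_ge p (g i m z : R) : 0 < g -> 0 < i -> 0 <= z ->
  (forall s, 0 <= s <= z -> m <= p.[s]) ->
  m / i <= (multp (fun k => (g * k%:R + i)^-1) p).[z].
Proof.
move=> g0 i0 z0 pm; set q := multp _ _.
have gi k : g * k%:R + i != 0.
  by rewrite gt_eqF// ltr_wpDl// mulr_ge0// ltW.
have qE : p = g *: ('X * q^`()) + i *: q.
  apply/polyP => -[|k]; rewrite coefD !coefZ coefXM coef_multp/=.
    by rewrite !mulr0 !add0r mulrA divff ?mul1r// gt_eqF.
  rewrite coef_deriv coef_multp -(mulr_natr (_ * _)).
  have := gi k.+1; move: (k.+1%:R) => x gix; by field.
have [c /andP[c0 cz] cmin] := poly_min q z0.
apply: le_trans (cmin z _); last by rewrite z0 lexx.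
rewrite ler_pdivrMr//; have pc := pm c; rewrite c0 cz in pc.
apply: le_trans (pc isT) _.
rewrite {1}qE hornerD !hornerZ hornerM hornerX [leRHS]mulrC gerDr.
apply: mulr_ge0_le0; first exact: ltW.
(* At [c = 0] the derivative term vanishes; elsewhere the derivative is nonpositive because [c] is
   also a minimum over [[0, c]]. *)
move: c0; rewrite le_eqVlt => /predU1P[<-|c0]; first by rewrite mul0r.
rewrite pmulr_rle0//; apply: deriv_le0_at_left_min => // s /andP[s0 sc].
by apply: cmin; rewrite s0 (le_trans sc).
Qed.

(** Partial product in Euler's formula: [n ^ a] times it tends to Gamma(x + 1) / Gamma(x + 1 -
    a). *)
Definition gamma_prod (a : R) n (x : R) :=
  \prod_(i < n) (1 - a / (x + i.+1%:R)).

(** By induction: expanding the products of two simple poles multiplies the old residue at [i] by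
    [1 - a / (n - i)], which is nonnegative as [a <= 1], and creates a residue at the new pole, a
    product of nonnegative factors. *)
Lemma gamma_prod_partial_fractions (a : R) n : 0 <= a <= 1 ->
  exists2 A : nat -> R, (forall i, 0 <= A i) &
    forall x : R, (forall j, (j < n)%N -> x + j.+1%:R != 0) ->
      gamma_prod a n x = 1 - \sum_(i < n) A i / (x + i.+1%:R).
Proof.
move=> /andP[a0 a1]; elim: n => [|n [A A0 IH]].
  by exists (fun=> 0) => // x _; rewrite /gamma_prod !big_ord0 subr0.
have nj i : (i < n)%N -> n%:R - i%:R >= 1 :> R.
  by move=> ni; rewrite lerBrDr nat1r ler_nat.
(* The new pole is none of the old ones, so the induction hypothesis evaluates the residue there. *)
have QE : gamma_prod a n (- n.+1%:R) =
    1 - \sum_(i < n) A i / (- n.+1%:R + i.+1%:R).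
  apply: IH => j jn; rewrite addrC subr_eq0 eqr_nat eqSS.
  by rewrite ltn_eqF.
exists (fun i => if i == n then a * gamma_prod a n (- n.+1%:R)
                 else A i * (1 - a / (n%:R - i%:R))).
  move=> i; case: eqP => [_|iNn].
    apply: mulr_ge0 => //; apply: prodr_ge0 => j _.
    rewrite subr_ge0 (@le_trans _ _ 0)// mulr_ge0_le0// invr_le0.
    by rewrite addrC subr_le0 ler_nat ltnW// ltnS.
  rewrite mulr_ge0// subr_ge0; have [ni|ni|//] := ltngtP i n.
    have ni0 : 0 < n%:R - i%:R :> R by rewrite (lt_le_trans ltr01)// nj.
    by rewrite ler_pdivrMr// mul1r (le_trans a1)// nj.
  (* Indices [i > n] do not enter the sum, but [A] must be nonnegative there too. *)
  rewrite (@le_trans _ _ 0)// mulr_ge0_le0// invr_le0 subr_le0.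
  by rewrite ler_nat ltnW.
move=> x xj; rewrite /gamma_prod !big_ord_recr/=.
rewrite -/(gamma_prod a n x) -/(gamma_prod a n (- n.+1%:R)).
rewrite IH; last by move=> j jn; apply: xj; rewrite ltnS ltnW.
rewrite eqxx QE; have xn := xj n (ltnSn n).
set w := (x + n.+1%:R)^-1.
under [in RHS]eq_bigr => i _ do rewrite (ltn_eqF (ltn_ord i)).
have -> : \sum_(i < n) A i * (1 - a / (n%:R - i%:R)) / (x + i.+1%:R) =
    \sum_(i < n) A i / (x + i.+1%:R) * (1 - a * w) +
    a * w * \sum_(i < n) A i / (- n.+1%:R + i.+1%:R).
  rewrite mulr_sumr -big_split/=; apply: eq_bigr => i _.
  rewrite /w.
  have xi := xj i (ltnW (ltn_ord i)); have ni := nj _ (ltn_ord i).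
  rewrite -(natr1 n) -(natr1 i) in xn xi *.
  have nin : n%:R - i%:R != 0 :> R by rewrite gt_eqF// (lt_le_trans ltr01).
  have nin' : - (n%:R + 1) + (i%:R + 1) != 0 :> R.
    by rewrite -oppr_eq0; move: nin; congr (_ != _); ring.
  by field; rewrite xi xn nin nin'.
rewrite -mulr_suml; ring.
Qed.


(** The operator is the identity minus nonnegative multiples of resolvents. Bounding each resolvent
    below by [p(z) / i] leaves the partial fraction expansion at 0 as the factor of [p(z)]. *)
Lemma multp_gamma_prod_le p (a g z : R) n : 0 <= a <= 1 -> 0 < g -> 0 <= z ->
  (forall s, 0 <= s <= z -> p.[z] <= p.[s]) ->
  (multp (fun k => gamma_prod a n (g * k%:R)) p).[z] <=
    gamma_prod a n 0 * p.[z].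
Proof.
move=> a01 g0 z0 pz; have [A A0 AE] := gamma_prod_partial_fractions n a01.
have gk k j : (j < n)%N -> g * k%:R + j.+1%:R != 0.
  by move=> _; rewrite gt_eqF// ltr_wpDl ?mulr_ge0// ltW.
have -> : multp (fun k => gamma_prod a n (g * k%:R)) p =
    p - \sum_(i < n) A i *: multp (fun k => (g * k%:R + i.+1%:R)^-1) p.
  apply/polyP => k; rewrite coef_multp coefB coef_sum AE; last exact: gk.
  rewrite mulrBl mul1r mulr_suml; congr (_ - _); apply: eq_bigr => i _.
  by rewrite coefZ coef_multp mulrA.
rewrite AE; last by move=> j _; rewrite add0r pnatr_eq0.
rewrite hornerD hornerN horner_sum mulrBl mul1r lerD2l lerN2 mulr_suml.
apply: ler_sum => i _; rewrite hornerZ add0r -mulrA ler_wpM2l// mulrC.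
exact: multp_resolvent_ge.
Qed.

Definition minimum_principle (Phi : nat -> R) := forall p (z : R), 0 <= z ->
  (forall s, 0 <= s <= z -> p.[z] <= p.[s]) -> (multp Phi p).[z] <= 0.

Lemma cvg_multp (w : nat -> nat -> R) (v : nat -> R) p z :
  (forall k, w n k @[n --> \oo] --> v k) ->
  (multp (w n) p).[z] @[n --> \oo] --> (multp v p).[z].
Proof.
move=> wv; rewrite /multp horner_poly.
under eq_fun do rewrite horner_poly.
apply: cvg_big => [|i _]; first exact: add_continuous.
apply: cvgM; last exact: cvg_cst.
by apply: cvgM; [exact: wv|exact: cvg_cst].
Qed.

(** Since [Phi 0 = 0], the constant term is removed from the approximating operators. Their value at
    [z] is then at most [c n * gamma_prod a n 0] times [p(z) - p(0)], hence nonpositive, and the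
    sign survives the limit. *)
Lemma minimum_principle_lim (Phi c : nat -> R) (a g : R) :
  0 <= a <= 1 -> 0 < g -> (forall n, 0 <= c n) -> Phi 0%N = 0 ->
  (forall k, (0 < k)%N ->
    c n * gamma_prod a n (g * k%:R) @[n --> \oo] --> Phi k) ->
  minimum_principle Phi.
Proof.
move=> a01 g0 c0 Phi0 cPhi p z z0 pz.
pose w n k := if k is 0%N then 0 else c n * gamma_prod a n (g * k%:R).
have wPhi k : w n k @[n --> \oo] --> Phi k.
  case: k => [|k]; first by rewrite Phi0; exact: cvg_cst.
  exact: cPhi.
apply: cvgr_to_le (cvg_multp wPhi) _; apply: nearW => n.
have -> : multp (w n) p = c n *: (multp (fun k => gamma_prod a n (g * k%:R)) p
    - (gamma_prod a n 0 * p`_0)%:P).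
  apply/polyP => -[|k]; rewrite coefZ coefB !coef_multp coefC/= ?mulr0.
    by rewrite subrr mulr0 mul0r.
  by rewrite subr0 mulrA.
rewrite hornerZ hornerD hornerN hornerC mulr_ge0_le0// subr_le0.
apply: le_trans (multp_gamma_prod_le n a01 g0 z0 pz) _.
rewrite ler_wpM2l//.
  apply: prodr_ge0 => i _; rewrite add0r subr_ge0 ler_pdivrMr// mul1r.
  by case/andP: a01 => _ /le_trans; apply; rewrite ler1n.
by rewrite -horner_coef0 pz// lexx.
Qed.

End coefficient_multipliers.

(** * Monotonicity of Mittag-Leffler type series *)

Section mittag_leffler_type_series.
Variable R : realType.
Variable Phi : nat -> R.
Hypothesis Phi0 : Phi 0%N = 0.
Hypothesis Phi_gt0 : forall k, (0 < k)%N -> 0 < Phi k.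

Definition ml_coef k : R := \prod_(u < k) (Phi u.+1)^-1.

Definition ml_poly N : {poly R} := \poly_(k < N) ((-1) ^+ k * ml_coef k).

Definition ml_fun (z : R) : R := limn (fun N => (ml_poly N).[z]).

Lemma ml_coef0 : ml_coef 0 = 1.
Proof. by rewrite /ml_coef big_ord0. Qed.

Lemma ml_coefS k : ml_coef k.+1 = ml_coef k / Phi k.+1.
Proof. by rewrite /ml_coef big_ord_recr. Qed.

Lemma ml_coef_gt0 k : 0 < ml_coef k.
Proof. by apply: prodr_gt0 => i _; rewrite invr_gt0 Phi_gt0. Qed.

Lemma normr_ml_term k (z : R) :
  `|(-1) ^+ k * ml_coef k * z ^+ k| = ml_coef k * `|z| ^+ k.
Proof.
rewrite !normrM normrX normrN1 expr1n mul1r normrX.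
by rewrite gtr0_norm// ml_coef_gt0.
Qed.

Lemma coef_ml_poly N k :
  (ml_poly N)`_k = if (k < N)%N then (-1) ^+ k * ml_coef k else 0.
Proof. by rewrite coef_poly. Qed.

Lemma horner_ml_polyS N z :
  (ml_poly N.+1).[z] = (ml_poly N).[z] + (-1) ^+ N * ml_coef N * z ^+ N.
Proof. by rewrite !horner_poly big_ord_recr. Qed.

(** The truncated eigenfunction equation: [Phi k] cancels the last factor of [ml_coef k], which
    lowers the truncation by one degree. *)
Lemma multp_ml_poly N : multp Phi (ml_poly N.+1) = - ('X * ml_poly N).
Proof.
apply/polyP => -[|k]; rewrite coefN coefXM coef_multp/= ?Phi0 ?mul0r ?oppr0//.
rewrite !coef_ml_poly ltnS; case: ifP => _; last by rewrite mulr0 oppr0.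
rewrite ml_coefS exprS; have := Phi_gt0 (ltn0Sn k).
by move=> /lt0r_neq0 Phik; field.
Qed.

Hypothesis Phi_min : minimum_principle Phi.

(** At a minimum point [c > 0] of the truncation, the minimum principle makes the previous
    truncation nonnegative, and the last term is all that can be lost. At [c = 0] the value is 1. *)
Lemma ml_poly_ge N (z Z : R) : 0 <= z <= Z ->
  - (ml_coef N * Z ^+ N) <= (ml_poly N.+1).[z].
Proof.
move=> /andP[z0 zZ]; have Z0 := le_trans z0 zZ.
have [c /andP[c0 cZ] cmin] := poly_min (ml_poly N.+1) Z0.
have := cmin z; rewrite z0 zZ => /(_ isT); apply: le_trans.
have PZ : 0 <= ml_coef N * Z ^+ N.
  by rewrite mulr_ge0 ?exprn_ge0// ltW// ml_coef_gt0.
move: c0; rewrite le_eqVlt => /predU1P[c0|c0].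
  rewrite -c0 horner_coef0 coef_ml_poly ml_coef0 mulr1 expr0.
  by rewrite (@le_trans _ _ 0)// oppr_le0.
have := Phi_min (ltW c0) (p := ml_poly N.+1).
rewrite multp_ml_poly hornerN hornerM hornerX oppr_le0 pmulr_rge0//.
have pc s : 0 <= s <= c -> (ml_poly N.+1).[c] <= (ml_poly N.+1).[s].
  by move=> /andP[s0 sc]; apply: cmin; rewrite s0 (le_trans sc).
move=> /(_ pc) p0; rewrite horner_ml_polyS -[leLHS]add0r lerD//.
rewrite lerNl (le_trans (ler_norm _))// normrN normr_ml_term gtr0_norm//.
by rewrite ler_pM2l ?ml_coef_gt0// lerXn2r// nnegrE ltW.
Qed.

(** The minimum principle is applied to the difference [d] of the dilated and the original
    truncation. At a minimum point [c > 0] it gives [y(a c) >= y(c) / a] one degree lower, so the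
    difference there is at least [(a^-1 - 1) y(c)], which [ml_poly_ge] bounds below. *)
Lemma ml_poly_scale_ge N (a z Z : R) : 0 < a <= 1 -> 0 <= z <= Z ->
  - ((a^-1 - 1) * (ml_coef N * Z ^+ N) + ml_coef N.+1 * Z ^+ N.+1) <=
    (ml_poly N.+2).[a * z] - (ml_poly N.+2).[z].
Proof.
move=> /andP[a0 a1] /andP[z0 zZ]; have Z0 := le_trans z0 zZ.
pose sc N := ml_poly N \Po (a *: 'X).
have coef_sc M k : (sc M)`_k = a ^+ k * (ml_poly M)`_k.
  rewrite /sc comp_polyE coef_sum.
  under eq_bigr do rewrite exprZn !coefZ coefXn.
  have [kM|kM] := ltnP k (size (ml_poly M)).
    rewrite (bigD1 (Ordinal kM))//= eqxx mulr1 big1 ?addr0 1?mulrC//.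
    by move=> i /negPf ik; rewrite (_ : (k == i) = false) ?mulr0// eq_sym.
  rewrite big1 ?[X in _ = _ * X]nth_default ?mulr0// => i _.
  by rewrite gtn_eqF ?mulr0// (leq_trans (ltn_ord i)).
have horner_sc M s : (sc M).[s] = (ml_poly M).[a * s].
  by rewrite /sc horner_comp hornerZ hornerX.
pose d := sc N.+2 - ml_poly N.+2.
have dE s : d.[s] = (ml_poly N.+2).[a * s] - (ml_poly N.+2).[s].
  by rewrite /d hornerD hornerN horner_sc.
have Phid : multp Phi d = - (a *: ('X * sc N.+1)) + 'X * ml_poly N.+1.
  apply/polyP => k.
  have := congr1 (fun p : {poly R} => p`_k) (multp_ml_poly N.+1).
  rewrite coefN coefD coefN coefZ !coefXM !coef_multp coefB coef_sc.
  case: k => [|k] /=; first by rewrite Phi0 !mul0r mulr0 oppr0 addr0.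
  rewrite coef_sc exprS => kE.
  rewrite mulrBr kE opprK mulrCA kE; ring.
have [c /andP[c0 cZ] cmin] := poly_min d Z0.
rewrite -dE; have := cmin z; rewrite z0 zZ => /(_ isT); apply: le_trans.
have a1V : 0 <= a^-1 - 1 by rewrite subr_ge0 invf_ge1.
have P0 M : 0 <= ml_coef M * Z ^+ M.
  by rewrite mulr_ge0 ?exprn_ge0// ltW// ml_coef_gt0.
move: c0; rewrite le_eqVlt => /predU1P[<-|c0].
  by rewrite dE mulr0 subrr oppr_le0 addr_ge0// mulr_ge0.
have := Phi_min (ltW c0) (p := d).
have dc s : 0 <= s <= c -> d.[c] <= d.[s].
  by move=> /andP[s0 sC]; apply: cmin; rewrite s0 (le_trans sC).
move=> /(_ dc).
rewrite Phid hornerD hornerN hornerZ !hornerM hornerX horner_sc.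
rewrite mulrCA -mulrN -mulrDr pmulr_rle0// addrC subr_le0 => pc.
have : (ml_poly N.+1).[c] / a <= (ml_poly N.+1).[a * c].
  by rewrite ler_pdivrMr// mulrC.
have pN : - (ml_coef N * Z ^+ N) <= (ml_poly N.+1).[c].
  by apply: ml_poly_ge; rewrite (ltW c0).
move: (ler_wpM2r a1V pN) => pN' pc'.
rewrite dE !(horner_ml_polyS N.+1) exprMn.
(* What remains is the term of degree [N.+1], changed by a factor [a ^+ N.+1 - 1] of absolute value
   at most 1. *)
suff : - (ml_coef N.+1 * Z ^+ N.+1) <=
    (-1) ^+ N.+1 * ml_coef N.+1 * c ^+ N.+1 * (a ^+ N.+1 - 1).
  move: pN' pc'; set x := (ml_poly _).[_]; set y := (ml_poly _).[_].
  set u := ml_coef N * _; set v := ml_coef N.+1 * _; set w := (-1) ^+ _.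
  set aV := a^-1; nra.
rewrite lerNl (le_trans (ler_norm _))// normrN normrM normr_ml_term.
rewrite (gtr0_norm c0).
rewrite -[leRHS]mulr1 ler_pM ?mulr_ge0 ?exprn_ge0//; try exact: ltW.
- by rewrite ltW// ml_coef_gt0.
- by rewrite ler_pM2l ?ml_coef_gt0// lerXn2r// nnegrE ltW.
- rewrite ler0_norm ?subr_le0 ?exprn_ile1 ?(ltW a0)//.
  by rewrite opprB lerBlDr lerDl exprn_ge0// ltW.
Qed.

Hypothesis Phi_cvgy : Phi k @[k --> \oo] --> +oo.

(** Once [Phi k >= 2 * Z], each term is at most half the preceding one. The constant sums the
    rescaled terms up to that index, so it dominates each of them. *)
Lemma ml_term_le (Z : R) : 0 <= Z ->
  exists C : R, forall k, ml_coef k * Z ^+ k <= C * 2^-1 ^+ k.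
Proof.
move=> Z0; have /cvgryPge/(_ (2 * Z))[K _ PhiK] := Phi_cvgy.
have P0 k : 0 <= ml_coef k * Z ^+ k.
  by rewrite mulr_ge0 ?exprn_ge0// ltW// ml_coef_gt0.
exists (\sum_(j < K.+1) ml_coef j * Z ^+ j * 2 ^+ j) => k.
rewrite exprVn ler_pdivlMr ?exprn_gt0//.
have leK j : (j <= K)%N -> ml_coef j * Z ^+ j * 2 ^+ j <=
    \sum_(j < K.+1) ml_coef j * Z ^+ j * 2 ^+ j.
  move=> jK; rewrite (bigD1 (inord j))//= inordK// lerDl sumr_ge0// => i _.
  by rewrite mulr_ge0 ?exprn_ge0.
have [/leK//|/ltnW Kk] := leqP k K.
apply: le_trans (leK _ (leqnn K)).
rewrite -(subnKC Kk); elim: (k - K)%N => [|j]; first by rewrite addn0.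
apply: le_trans; rewrite addnS ml_coefS !exprS.
have /PhiK/= Phi2 : (K <= (K + j).+1)%N by rewrite leqW// leq_addr.
have PhiP := Phi_gt0 (ltn0Sn (K + j)).
have -> : ml_coef (K + j) / Phi (K + j).+1 * (Z * Z ^+ (K + j)) *
    (2 * 2 ^+ (K + j)) = ml_coef (K + j) * Z ^+ (K + j) * 2 ^+ (K + j) *
    (2 * Z / Phi (K + j).+1) by ring.
rewrite ler_piMr ?ler_pdivrMr ?mul1r//.
by rewrite !mulr_ge0 ?exprn_ge0// ltW// ml_coef_gt0.
Qed.

Lemma ml_term_cvg0 (Z : R) : 0 <= Z -> ml_coef k * Z ^+ k @[k --> \oo] --> 0.
Proof.
move=> Z0; have [C CP] := ml_term_le Z0.
apply: (@squeeze_cvgr _ _ _ _ (cst 0) (fun k => C * 2^-1 ^+ k)).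
- apply: nearW => k; rewrite CP andbT.
  by rewrite mulr_ge0 ?exprn_ge0// ltW// ml_coef_gt0.
- exact: cvg_cst.
- by apply: cvg_geometric; rewrite ger0_norm ?invr_ge0// invf_lt1 ?ltr1n.
Qed.

Lemma is_cvg_ml_poly (z : R) : cvgn (fun N => (ml_poly N).[z]).
Proof.
have [C CP] := ml_term_le (normr_ge0 z).
have -> : (fun N => (ml_poly N).[z]) =
    series (fun k => (-1) ^+ k * ml_coef k * z ^+ k).
  by apply/funext => N; rewrite horner_poly seriesEord.
have CP0 k : 0 <= C * 2^-1 ^+ k.
  apply: le_trans (CP k); rewrite mulr_ge0 ?exprn_ge0//.
  by rewrite ltW// ml_coef_gt0.
apply/normed_cvg/(@series_le_cvg _ _ (fun k => C * 2^-1 ^+ k)) => //.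
- by move=> k /=.
- by move=> k /=; rewrite normr_ml_term.
apply: is_cvg_geometric_series.
by rewrite ger0_norm ?invr_ge0// invf_lt1 ?ltr1n.
Qed.

(** Limit of [ml_poly_scale_ge], whose error terms are terms of a convergent series. *)
Lemma ml_fun_nonincreasing (a z : R) : 0 < a <= 1 -> 0 <= z ->
  ml_fun z <= ml_fun (a * z).
Proof.
move=> a01 z0; rewrite -subr_ge0.
have cz := is_cvg_ml_poly (z := z); have caz := is_cvg_ml_poly (z := a * z).
have c0 := ml_term_cvg0 z0.
have l0 : - ((a^-1 - 1) * (ml_coef N * z ^+ N) + ml_coef N.+1 * z ^+ N.+1)
    @[N --> \oo] --> (- ((a^-1 - 1) * 0 + 0) : R).
  apply: cvgN; apply: cvgD; first exact: cvgMr.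
  by rewrite (cvg_shiftS (fun N => ml_coef N * z ^+ N)).
rewrite mulr0 addr0 oppr0 in l0.
have l1 : (ml_poly N.+2).[a * z] - (ml_poly N.+2).[z] @[N --> \oo] -->
    ml_fun (a * z) - ml_fun z.
  apply: cvgB.
    rewrite (cvg_shiftS (fun N => (ml_poly N.+1).[a * z])).
    by rewrite (cvg_shiftS (fun N => (ml_poly N).[a * z])).
  rewrite (cvg_shiftS (fun N => (ml_poly N.+1).[z])).
  by rewrite (cvg_shiftS (fun N => (ml_poly N).[z])).
apply: (ler_cvg_to l0 l1); apply: nearW => N.
by apply: ml_poly_scale_ge => //; rewrite z0 lexx.
Qed.

(** At a small point [z1] the first-order term dominates the rest of the series, so the sum is
    strictly below 1; monotonicity carries the bound to all [z >= z1]. *)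
Lemma ml_fun_lt1 (b z0 : R) : 0 < b -> (forall k, (0 < k)%N -> b <= Phi k) ->
  0 < z0 -> exists2 c : R, 0 < c & forall z, z0 <= z -> ml_fun z <= 1 - c.
Proof.
move=> b0 bPhi z00; pose z1 := Num.min z0 (b / 4).
have z10 : 0 < z1 by rewrite lt_min z00 divr_gt0.
pose t := ml_coef 1 * z1.
have t0 : 0 < t by rewrite mulr_gt0// ml_coef_gt0.
(* Consecutive terms have ratio [z1 / Phi k], at most 1/4 because [z1 <= b / 4]. *)
have tk k : ml_coef k.+1 * z1 ^+ k.+1 <= t * 4^-1 ^+ k.
  elim: k => [|k IH]; first by rewrite expr1 expr0 mulr1.
  rewrite ml_coefS [z1 ^+ _]exprSr [4^-1 ^+ _]exprSr mulrA [leRHS]mulrA.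
  have -> : ml_coef k.+1 / Phi k.+2 * (z1 ^+ k.+1) * z1 =
    ml_coef k.+1 * z1 ^+ k.+1 * (z1 / Phi k.+2) by ring.
  have P2 := Phi_gt0 (ltn0Sn k.+1).
  rewrite ler_pM ?mulr_ge0 ?invr_ge0 ?exprn_ge0//; try exact: ltW.
    by rewrite ltW// ml_coef_gt0.
  rewrite ler_pdivrMr// mulrC ge_min; apply/orP; right.
  by rewrite ler_pM2r ?invr_gt0// bPhi.
(* The bound is an equality at [N = 0]; the vanishing part [4^-1 ^+ N / 2] pays for the remaining
   terms. *)
have pt N : (ml_poly N.+2).[z1] <= 1 - t * (2^-1 + 4^-1 ^+ N / 2).
  elim: N => [|N IH].
    rewrite !horner_ml_polyS horner_poly big_ord0 !expr0 expr1 add0r.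
    by rewrite ml_coef0 !mulr1 mulN1r (expr1 z1) mulNr -/t; lra.
  rewrite horner_ml_polyS; have tN := tk N.+1.
  have : (-1) ^+ N.+2 * ml_coef N.+2 * z1 ^+ N.+2 <= ml_coef N.+2 * z1 ^+ N.+2.
    by rewrite (le_trans (ler_norm _))// normr_ml_term gtr0_norm.
  have : 0 <= t * 4^-1 ^+ N by rewrite mulr_ge0 ?exprn_ge0// ltW.
  move: IH tN; rewrite [4^-1 ^+ N.+1]exprS.
  set A := (ml_poly _).[_]; set B := ml_coef N.+2 * _.
  set D := (-1) ^+ _ * _ * _.
  set q := 4^-1 ^+ N; lra.
exists (t / 2) => [|z zz0]; first by rewrite divr_gt0.
have z1z : z1 <= z by rewrite (le_trans _ zz0)// ge_min lexx.
have z0' : 0 < z by exact: lt_le_trans z10 z1z.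
apply: (@le_trans _ _ (ml_fun z1)).
  rewrite -(divfK (lt0r_neq0 z0') z1).
  apply: ml_fun_nonincreasing; last exact: ltW.
  by rewrite divr_gt0//= ler_pdivrMr// mul1r.
have cz : (ml_poly N.+2).[z1] @[N --> \oo] --> ml_fun z1.
  rewrite (cvg_shiftS (fun N => (ml_poly N.+1).[z1])).
  rewrite (cvg_shiftS (fun N => (ml_poly N).[z1])).
  exact: is_cvg_ml_poly.
apply: cvgr_to_le cz _; apply: nearW => N.
apply: le_trans (pt N) _; rewrite lerD2l lerN2 ler_pM2l//.
by rewrite lerDl divr_ge0// exprn_ge0.
Qed.

End mittag_leffler_type_series.

(** * The Gamma function *)

Section integrable_EFin.
Context d (T : measurableType d) (R : realType).
Variables (mu : {measure set T -> \bar R}) (D : set T) (mD : measurable D).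
Implicit Types f g : T -> R.

Lemma integrable_EFinZ k f : mu.-integrable D (EFin \o f) ->
  mu.-integrable D (EFin \o (fun x => k * f x)).
Proof. by move=> /(integrableZl mD k). Qed.

Lemma integrable_EFinD f g :
  mu.-integrable D (EFin \o f) -> mu.-integrable D (EFin \o g) ->
  mu.-integrable D (EFin \o (fun x => f x + g x)).
Proof. by move=> /(integrableD mD)/[apply]. Qed.

Lemma integrable_EFinB f g :
  mu.-integrable D (EFin \o f) -> mu.-integrable D (EFin \o g) ->
  mu.-integrable D (EFin \o (fun x => f x - g x)).
Proof. by move=> /(integrableB mD)/[apply]. Qed.

End integrable_EFin.

Section gamma.
Variable R : realType.
Local Notation mu := (@lebesgue_measure R).
Implicit Types s t x th : R.

Definition gamma_integrand s t : R := t `^ s * expR (- t).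

Lemma gamma_integrand_ge0 s t : 0 <= gamma_integrand s t.
Proof. by rewrite mulr_ge0 ?powR_ge0 ?expR_ge0. Qed.

(** Raising [u <= exp u], at [u = t / (2 s)], to the power [s] bounds [t ^ s] by [(2 s) ^ s] times
    [exp (t / 2)]. The case [s = 0] is separate because of the division. *)
Lemma gamma_integrand_le s : 0 <= s ->
  exists2 M : R, 0 <= M &
    forall t, 0 <= t -> gamma_integrand s t <= M * expR (- (t / 2)).
Proof.
move=> s0.
suff [M M0 MP] : exists2 M : R, 0 <= M &
    forall t, 0 <= t -> t `^ s <= M * expR (t / 2).
  exists M => // t t0; rewrite /gamma_integrand.
  have -> : expR (- (t / 2)) = expR (t / 2) * expR (- t).
    by rewrite -expRD; congr expR; lra.
  by rewrite mulrA ler_wpM2r ?expR_ge0// MP.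
move: s0; rewrite le_eqVlt => /predU1P[<-|s0].
  exists 1 => // t t0; rewrite powRr0 mul1r.
  by apply: le_trans (expR_ge1Dx _); rewrite lerDl divr_ge0.
have s20 : 0 < 2 * s by rewrite mulr_gt0.
exists ((2 * s) `^ s) => [|t t0]; first exact: powR_ge0.
have -> : expR (t / 2) = (expR (t / (2 * s))) `^ s.
  by rewrite -expRM; congr expR; have := lt0r_neq0 s0 => s0'; field.
rewrite -powRM ?expR_ge0 ?(ltW s20)// ge0_ler_powR ?nnegrE ?(ltW s0)//.
  by rewrite mulr_ge0 ?expR_ge0 ?(ltW s20).
rewrite -ler_pdivrMl// mulrC; apply: le_trans (expR_ge1Dx _).
by rewrite lerDr.
Qed.

Lemma is_derive_gamma_integrand s t : 0 < t ->
  is_derive t 1 (gamma_integrand s)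
    (s * gamma_integrand (s - 1) t - gamma_integrand s t).
Proof.
move=> t0; rewrite /gamma_integrand.
have d1 := is_derive1_powR s t0.
apply: is_derive_eq; rewrite /GRing.scale/=; ring.
Qed.

Lemma gamma_integrand_cvg_at_right s : 0 <= s ->
  gamma_integrand s t @[t --> 0^'+] --> gamma_integrand s 0.
Proof.
move=> s0; apply: cvgM; last first.
  apply/cvg_at_right_filter.
  by apply: continuous_comp; [exact: continuousN|exact: continuous_expR].
move: s0; rewrite le_eqVlt => /predU1P[<-|s0].
  by under eq_fun do rewrite powRr0; rewrite powRr0; exact: cvg_cst.
by rewrite powR0 ?gt_eqF//; exact: powR_cvg0.
Qed.

Lemma within_continuous_gamma_integrand s : 0 <= s ->
  {within `[0, +oo[, continuous (gamma_integrand s)}.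
Proof.
move=> s0; apply/continuous_within_itvcyP; split.
  move=> t; rewrite in_itv/= andbT => t0.
  apply/differentiable_continuous/derivable1_diffP.
  by have [] := is_derive_gamma_integrand s t0.
exact: gamma_integrand_cvg_at_right.
Qed.

Lemma measurable_gamma_integrand s : measurable_fun setT (gamma_integrand s).
Proof.
apply: measurable_funM => //.
exact: measurableT_comp.
Qed.

Lemma cvgy_expR_half : expR (- (t / 2)) @[t --> +oo] --> (0 : R).
Proof.
apply: (@cvg_comp _ _ _ (fun t => t / 2) (fun t => expR (- t)) _
  (pinfty_nbhs R)).
  exact: gt0_cvgMly.
exact: cvgr_expR.
Qed.

Lemma is_derive_expR_half t :
  is_derive t 1 (fun t => expR (- (t / 2))) (- (expR (- (t / 2)) / 2)).
Proof.
apply: is_derive_eq; rewrite /GRing.scale/=; ring.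
Qed.

Lemma continuous_expR_half : continuous (fun t : R => expR (- (t / 2))).
Proof.
move=> t; apply/differentiable_continuous/derivable1_diffP.
by have [] := is_derive_expR_half t.
Qed.

Lemma integral_expR_half :
  (\int[mu]_(t in `[0%R, +oo[) (expR (- (t / 2)))%:E = 2%:E)%E.
Proof.
have dF t : is_derive t 1 (fun t => - 2 * expR (- (t / 2))) (expR (- (t / 2))).
  by apply: is_derive_eq; rewrite /GRing.scale/=; field.
rewrite (@ge0_continuous_FTC2y _ _ (fun t => - 2 * expR (- (t / 2))) 0 0).
- by rewrite mul0r oppr0 expR0 mulr1 sub0e EFinN oppeK.
- by move=> t _; exact: expR_ge0.
- by apply: continuous_subspaceT; exact: continuous_expR_half.
- by rewrite -[X in _ --> X](mulr0 (- 2)); apply: cvgMr; exact: cvgy_expR_half.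
- by move=> t _; case: (dF t).
- by apply/cvg_at_right_filter; apply: cvgMr; exact: continuous_expR_half.
- by move=> t _; rewrite derive1E; exact: (@derive_val _ _ _ _ _ _ _ (dF t)).
Qed.

Lemma integrable_expR_half :
  mu.-integrable `]0, +oo[ (EFin \o (fun t : R => expR (- (t / 2)))).
Proof.
have mf : measurable_fun setT (fun t : R => expR (- (t / 2))).
  by apply: continuous_measurable_fun; exact: continuous_expR_half.
apply/integrableP; split.
  by apply/measurable_EFinP; exact: measurable_funTS.
under eq_integral do rewrite /= ger0_norm ?expR_ge0//.
rewrite integral_itv_obnd_cbnd; first by rewrite integral_expR_half ltry.
by apply/measurable_EFinP; exact: measurable_funTS.
Qed.

Lemma integrable_gamma_integrand s : 0 <= s ->
  mu.-integrable `]0, +oo[ (EFin \o gamma_integrand s).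
Proof.
move=> s0; have [M M0 MP] := gamma_integrand_le s0.
apply: (@le_integrable _ _ _ mu _ _ _
  (fun t => M%:E * (expR (- (t / 2)))%:E)%E) => //.
- by apply/measurable_EFinP/measurable_funTS; exact: measurable_gamma_integrand.
- move=> t /=; rewrite in_itv/= andbT => /ltW t0.
  rewrite lee_fin !ger0_norm ?gamma_integrand_ge0 ?mulr_ge0 ?expR_ge0//.
  exact: MP.
- by apply: integrableZl => //; exact: integrable_expR_half.
Qed.

Lemma gamma_integrand_cvgy s : 0 <= s ->
  gamma_integrand s t @[t --> +oo] --> (0 : R).
Proof.
move=> s0; have [M M0 MP] := gamma_integrand_le s0.
apply: (@squeeze_cvgr _ _ _ _ (cst 0) (fun t => M * expR (- (t / 2)))).
- apply: filterS (nbhs_pinfty_ge (num_real 0)) => t t0 /=.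
  by rewrite gamma_integrand_ge0/= MP.
- exact: cvg_cst.
- by rewrite -[X in _ --> X](mulr0 M); apply: cvgMr; exact: cvgy_expR_half.
Qed.

Lemma GammaE x : Gamma x = \int[mu]_(t in `]0, +oo[) gamma_integrand (x - 1) t.
Proof. by []. Qed.

(* The derivative of [gamma_integrand x] changes sign; adding a multiple of
   [expR (- (t / 2))] makes it nonnegative, as the fundamental theorem of
   calculus on a half-line requires. *)
Lemma GammaD1 x : 1 <= x -> Gamma (x + 1) = x * Gamma x.
Proof.
move=> x1; have x0 : 0 <= x by rewrite (le_trans ler01).
have x10 : 0 <= x - 1 by rewrite subr_ge0.
have [M M0 MP] := gamma_integrand_le x10.
pose e t : R := expR (- (t / 2)).
(* [f] is the derivative of [F]; the choice of [M] makes [x * M * e t] dominate the subtracted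
   term. *)
pose f t := x * M * e t + gamma_integrand x t - x * gamma_integrand (x - 1) t.
pose F t := - (2 * (x * M)) * e t - gamma_integrand x t.
have ix := integrable_gamma_integrand x0.
have ix1 := integrable_gamma_integrand x10.
have ie := integrable_expR_half.
have ixM : mu.-integrable `]0, +oo[ (EFin \o (fun t => x * M * e t)).
  by exact: integrable_EFinZ.
have ixx : mu.-integrable `]0, +oo[
    (EFin \o (fun t => x * gamma_integrand (x - 1) t)).
  by exact: integrable_EFinZ.
have ixMx : mu.-integrable `]0, +oo[
    (EFin \o (fun t => x * M * e t + gamma_integrand x t)).
  by exact: integrable_EFinD.
have iE : \int[mu]_(t in `]0, +oo[) f t =
    x * M * 2 + Gamma (x + 1) - x * Gamma x.
  rewrite RintegralB// RintegralD// !RintegralZl// GammaE addrK.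
  congr (_ * _ + _ - _ * _).
  by rewrite /Rintegral integral_itv_obnd_cbnd ?integral_expR_half//;
    case/integrableP: ie.
have if_ : mu.-integrable `]0, +oo[ (EFin \o f).
  by exact: integrable_EFinB.
have fE : \int[mu]_(t in `]0, +oo[) f t = 0 - F 0.
  rewrite Rintegral_itv_obnd_cbnd//; apply: Rintegral_ge0_continuous_FTC2y.
  - move=> t t0; have := gamma_integrand_ge0 x t; have := MP t t0.
    rewrite /f /e; set A := gamma_integrand _ _; set B := expR _.
    set C := gamma_integrand _ _ => AB C0.
    rewrite -addrA addrCA addr_ge0// subr_ge0 -mulrA.
    by rewrite ler_wpM2l.
  - rewrite /f => t; apply: cvgB; first apply: cvgD.
    + by apply: cvgMr; apply: continuous_subspaceT; exact: continuous_expR_half.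
    + exact: within_continuous_gamma_integrand.
    + by apply: cvgMr; exact: within_continuous_gamma_integrand.
  - rewrite -[X in _ --> X](subrr 0) -[X in X - _](mulr0 (- (2 * (x * M)))).
    apply: cvgB; last exact: gamma_integrand_cvgy.
    by apply: cvgMr; exact: cvgy_expR_half.
  - move=> t t0; apply: derivableB.
      by apply: derivableM => //; case: (is_derive_expR_half t).
    by case: (is_derive_gamma_integrand x t0).
  - apply: cvgB; last exact: gamma_integrand_cvg_at_right.
    by apply/cvg_at_right_filter; apply: cvgMr; exact: continuous_expR_half.
  - move=> t; rewrite in_itv/= andbT => t0.
    have d := is_derive_gamma_integrand x t0; have d' := is_derive_expR_half t.
    rewrite derive1E; apply: (derive_val (is_derive := _)).
    apply: is_derive_eq; rewrite /f /e /GRing.scale/=; lra.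
(* [gamma_integrand x] vanishes at 0, so only the auxiliary exponential contributes; it cancels its
   own integral in [iE]. *)
have : F 0 = - (x * M * 2).
  rewrite /F /gamma_integrand powR0 ?gt_eqF ?(lt_le_trans ltr01)//.
  by rewrite /e !mul0r oppr0 expR0; ring.
move: fE; rewrite iE => /eqP; lra.
Qed.

(** On [[1, 2]] the integrand is at least [exp (- 2)], since [t >= 1] and the exponent [x - 1] is
    nonnegative. *)
Lemma Gamma_gt0 x : 1 <= x -> 0 < Gamma x.
Proof.
move=> x1; have x10 : 0 <= x - 1 by rewrite subr_ge0.
have ix := integrable_gamma_integrand x10.
apply: (@lt_le_trans _ _ (expR (- 2))); first exact: expR_gt0.
have i12 : mu.-integrable `[1, 2] (EFin \o gamma_integrand (x - 1)).
  apply: integrableS ix => // t /=; rewrite !in_itv/= andbT => /andP[t1 _].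
  exact: lt_le_trans t1.
have mu12 : mu `[(1 : R), 2] = 1%E.
  rewrite lebesgue_measure_itv/= lte_fin ltr1n -EFinB; congr EFin; lra.
have c12 : \int[mu]_(t in `[1, 2]) expR (- 2) = expR (- 2) :> R.
  by rewrite -[RHS]mulr1 -[X in _ * X]/(fine 1%E) -mu12 Rintegral_cst.
apply: (@le_trans _ _ (\int[mu]_(t in `[1, 2]) gamma_integrand (x - 1) t)).
  rewrite -c12; apply: le_Rintegral => //.
    apply: measurable_bounded_integrable => //.
    - by apply: (@le_lt_trans _ _ 1%E); [rewrite -mu12|exact: ltry].
    - exact: bounded_cst.
  move=> t /=; rewrite in_itv/= => /andP[t1 t2].
  rewrite -[leLHS]mul1r ler_pM ?expR_ge0//.
    by apply: (@le_trans _ _ (t `^ 0)); [rewrite powRr0|exact: ler_powR].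
  by rewrite ler_expR lerN2.
rewrite GammaE /Rintegral fine_le//; try exact: integrable_fin_num.
apply: ge0_subset_integral => //.
- by case/integrableP: ix.
- by move=> t _; rewrite lee_fin gamma_integrand_ge0.
- move=> t /=; rewrite !in_itv/= andbT => /andP[t1 _].
  exact: lt_le_trans t1.
Qed.

(** Young's inequality for [s ^ th] and 1, with exponents [1 / th] and [1 / (1 - th)]. *)
Lemma powR_le_tangent s th : 0 <= s -> 0 <= th <= 1 ->
  s `^ th <= 1 - th + th * s.
Proof.
move=> s0 /andP[]; rewrite le_eqVlt => /predU1P[<- _|th0].
  by rewrite powRr0 subr0 mul0r addr0.
rewrite le_eqVlt => /predU1P[->|th1].
  by rewrite powRr1// subrr add0r mul1r.
have := @conjugate_powR R (s `^ th) 1 th^-1 (1 - th)^-1.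
rewrite powR_ge0 ler01 !invr_gt0 th0 subr_gt0 th1 !invrK addrC subrK.
move=> /(_ isT isT isT isT erefl); rewrite -powRrM mulfV ?gt_eqF// powRr1//.
by rewrite powR1 mul1r mulr1 addrC mulrC.
Qed.

(** The concave function [t ^ th] lies below its tangent at [t = x]. Integrated against the density
    of Gamma(x), the tangent gives [x ^ th * Gamma x], because Gamma(x + 1) = x Gamma(x) makes [x]
    the mean. *)
Lemma GammaD_le x th : 1 <= x -> 0 <= th <= 1 ->
  Gamma (x + th) <= x `^ th * Gamma x.
Proof.
move=> x1 th01; have x10 : 0 <= x - 1 by rewrite subr_ge0.
have x0 : 0 < x by rewrite (lt_le_trans ltr01).
case/andP: (th01) => th0 th1.
have xth : 0 <= x + th - 1 by rewrite addrAC addr_ge0.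
have ix := integrable_gamma_integrand (ltW x0).
have ix1 := integrable_gamma_integrand x10.
have ixt := integrable_gamma_integrand xth.
pose a := x `^ th * (1 - th); pose b := x `^ th * th / x.
have ia : mu.-integrable `]0, +oo[
    (EFin \o (fun t => a * gamma_integrand (x - 1) t)).
  by exact: integrable_EFinZ.
have ib : mu.-integrable `]0, +oo[ (EFin \o (fun t => b * gamma_integrand x t)).
  by exact: integrable_EFinZ.
have iab : mu.-integrable `]0, +oo[ (EFin \o (fun t =>
    a * gamma_integrand (x - 1) t + b * gamma_integrand x t)).
  by exact: integrable_EFinD.
apply: (@le_trans _ _ (\int[mu]_(t in `]0, +oo[)
    (a * gamma_integrand (x - 1) t + b * gamma_integrand x t))).
  rewrite GammaE; apply: le_Rintegral => //.
  move=> t /=; rewrite in_itv/= andbT => t0.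
  have := powR_le_tangent (divr_ge0 (ltW t0) (ltW x0)) th01.
  rewrite -(ler_pM2l (powR_gt0 th x0)) -powRM ?divr_ge0 ?(ltW t0) ?(ltW x0)//.
  rewrite mulrCA mulfV ?gt_eqF// mulr1.
  rewrite -(ler_pM2l (powR_gt0 (x - 1) t0)) -(ler_pM2r (expR_gt0 (- t))).
  rewrite -powRD; last by rewrite (gt_eqF t0) implybT.
  have -> : x - 1 + th = x + th - 1 by ring.
  rewrite /gamma_integrand -(mulr_powRB1 (ltW t0) x0).
  move=> /le_trans; apply.
  rewrite le_eqVlt; apply/orP; left; apply/eqP.
  by rewrite /a /b; ring.
rewrite RintegralD// !RintegralZl// -GammaE.
have -> : \int[mu]_(t in `]0, +oo[) gamma_integrand x t = x * Gamma x.
  by rewrite -GammaD1// GammaE addrK.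
rewrite le_eqVlt; apply/orP; left; apply/eqP.
by rewrite /a /b; have := lt0r_neq0 x0 => x0'; field.
Qed.

End gamma.

(** * Ratios of Gamma functions *)

Section gamma_ratio.
Variables (R : realType) (a : R).
Hypothesis a01 : 0 < a <= 1.

Let a0 : 0 < a. Proof. by case/andP: a01. Qed.
Let a1 : a <= 1. Proof. by case/andP: a01. Qed.

(** The factor by which the fractional derivative of order [a] maps the power [x] to the power
    [x - a]. *)
Definition gamma_ratio (x : R) : R := Gamma (x + 1) / Gamma (x + 1 - a).

Lemma gamma_ratio_gt0 x : a <= x -> 0 < gamma_ratio x.
Proof. by move=> ax; rewrite divr_gt0// Gamma_gt0//; have := a0; lra. Qed.

Lemma gamma_ratioD1 x : a <= x ->
  gamma_ratio x = gamma_ratio (x + 1) * (1 - a / (x + 1)).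
Proof.
move=> ax; rewrite /gamma_ratio [Gamma (x + 1 + 1)]GammaD1; last first.
  by have := a0; lra.
rewrite (_ : x + 1 + 1 - a = x + 1 - a + 1); last by ring.
rewrite [Gamma (x + 1 - a + 1)]GammaD1; last by lra.
have G0 : Gamma (x + 1 - a) != 0 by rewrite gt_eqF// Gamma_gt0//; lra.
field; rewrite G0/=; apply/andP; split; rewrite gt_eqF//; have := a0; lra.
Qed.

Lemma gamma_ratioDn x n : a <= x ->
  gamma_ratio x = gamma_ratio (x + n%:R) * gamma_prod a n x.
Proof.
move=> ax; elim: n => [|n IH].
  by rewrite /gamma_prod big_ord0 mulr1 addr0.
rewrite IH gamma_ratioD1; last by rewrite (le_trans ax)// lerDl.
rewrite -addrA natr1 /gamma_prod big_ord_recr/= -mulrA.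
by congr (_ * _); rewrite mulrC.
Qed.

(** [GammaD_le] with increment [1 - a] from [x]. The companion upper bound uses increment [a] from
    [x + 1 - a]. *)
Lemma gamma_ratio_ge x : 1 <= x -> x `^ a <= gamma_ratio x.
Proof.
move=> x1; have x0 : 0 < x by rewrite (lt_le_trans ltr01).
rewrite /gamma_ratio ler_pdivlMr; last by rewrite Gamma_gt0//; have := a1; lra.
have th : 0 <= 1 - a <= 1 by have := a0; have := a1; lra.
have := GammaD_le x1 th; rewrite addrA => /(ler_wpM2l (powR_ge0 x a)).
move=> /le_trans; apply; rewrite mulrA -powRD; last first.
  by rewrite (gt_eqF x0) implybT.
by rewrite addrC subrK powRr1 ?(ltW x0)// GammaD1.
Qed.

Lemma gamma_ratio_le x : a <= x -> gamma_ratio x <= (x + 1) `^ a.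
Proof.
move=> ax; have x1 : 1 <= x + 1 - a by lra.
rewrite /gamma_ratio ler_pdivrMr ?Gamma_gt0//.
have th : 0 <= a <= 1 by rewrite ltW//=.
have := GammaD_le x1 th; rewrite subrK => /le_trans; apply.
rewrite ler_wpM2r ?(ltW (Gamma_gt0 _))// ge0_ler_powR ?nnegrE ?(ltW a0)//;
  have := a0; lra.
Qed.

(** By [gamma_ratioDn] the product is [gamma_ratio x / gamma_ratio (x + n)], and the two power
    bounds squeeze [gamma_ratio (x + n)] against [n ^ a]. *)
Lemma gamma_ratio_lim x : a <= x ->
  n%:R `^ a * gamma_prod a n x @[n --> \oo] --> gamma_ratio x.
Proof.
move=> ax; have x0 : 0 < x by apply: lt_le_trans ax.
have xn0 n : 0 < x + n%:R by rewrite ltr_wpDr.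
suff c1 : (n%:R `^ a / gamma_ratio (x + n%:R)) @[n --> \oo] --> (1 : R).
  rewrite -[X in _ --> X]mulr1.
  rewrite (_ : (fun n => _) = (fun n =>
    gamma_ratio x * (n%:R `^ a / gamma_ratio (x + n%:R)))).
    by apply: cvgM => //; exact: cvg_cst.
  apply/funext => n; rewrite [in RHS](gamma_ratioDn n ax).
  have : gamma_ratio (x + n%:R) != 0.
    by rewrite gt_eqF// gamma_ratio_gt0// (le_trans ax)// lerDl.
  by move=> ?; field.
have cv : (x + 1 + n%:R)^-1 @[n --> \oo] --> (0 : R).
  apply/gtr0_cvgV0; first by apply: nearW => n; rewrite -addrA ltr_wpDr.
  have := cvgr_idn (R := R); apply: ger_cvgy; apply: nearW => n.
  by rewrite lerDr -[leLHS]add0r lerD// ltW.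
apply: (@squeeze_cvgr _ _ _ _ (fun n => 1 - (x + 1) * (x + 1 + n%:R)^-1)
  (cst 1)).
- exists 1%N => // n /= n1.
  have n0 : 0 < n%:R :> R by rewrite ltr0n.
  have xn1 : 0 < x + 1 + n%:R by rewrite -addrA ltr_wpDr.
  have g0 : 0 < gamma_ratio (x + n%:R).
    by rewrite gamma_ratio_gt0// (le_trans ax)// lerDl.
  have xn : 1 <= x + n%:R by rewrite (@le_trans _ _ n%:R) ?ler1n// lerDr ltW.
  rewrite /= ler_pdivrMr// mul1r; apply/andP; split; last first.
    apply: le_trans (gamma_ratio_ge xn).
    by rewrite ge0_ler_powR ?nnegrE ?(ltW a0) ?(ltW (xn0 n)) ?lerDr ?(ltW x0).
  have -> : 1 - (x + 1) / (x + 1 + n%:R) = n%:R / (x + 1 + n%:R).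
    by have := lt0r_neq0 xn1 => ?; field.
  set t := _ / (_ + _); have t01 : 0 < t <= 1.
    by rewrite /t divr_gt0//= ler_pdivrMr// mul1r lerDr ltW// ltr_wpDr.
  apply: (@le_trans _ _ (t `^ a)); first exact: ger1_powR.
  rewrite ler_pdivlMr// /t.
  have axn : a <= x + n%:R by rewrite (le_trans ax)// lerDl.
  apply: (le_trans (ler_wpM2l (powR_ge0 _ _) (gamma_ratio_le axn))).
  rewrite -powRM ?divr_ge0 ?(ltW n0) ?(ltW xn1)//; last by rewrite addrAC ltW.
  by rewrite [x + n%:R + 1]addrAC divfK// lt0r_neq0.
- rewrite -[X in _ --> X](subr0 1) -[X in 1 - X](mulr0 (x + 1)).
  by apply: cvgB; [exact: cvg_cst|apply: cvgMr].
- exact: cvg_cst.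
Qed.

End gamma_ratio.

(** * The lower bound on the singular values *)

Section sigma_lower_bound.
Variables (R : realType) (alpha beta : R).
Hypotheses (halpha : 0 < alpha <= 1) (hbeta : 0 <= beta).

Let a0 : 0 < alpha. Proof. by case/andP: halpha. Qed.
Let a1 : alpha <= 1. Proof. by case/andP: halpha. Qed.

(* The Caputo derivative of order [alpha] maps [x ^ ((alpha + beta) k)] to
   [caputo_mult k * x ^ ((alpha + beta) (k - 1) + beta)]. *)
Definition caputo_mult k : R :=
  if k is 0%N then 0 else gamma_ratio alpha ((alpha + beta) * k%:R).

Local Notation P := (ml_coef caputo_mult).

Let ge_alpha k : (0 < k)%N -> alpha <= (alpha + beta) * k%:R.
Proof.
move=> k0; rewrite -[leLHS]mulr1 ler_pM ?ler1n ?(ltW a0)//.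
by rewrite lerDl.
Qed.

Lemma caputo_mult_gt0 k : (0 < k)%N -> 0 < caputo_mult k.
Proof. by case: k => // k _; rewrite gamma_ratio_gt0// ge_alpha. Qed.

Lemma caputo_mult_cvgy : caputo_mult k @[k --> \oo] --> +oo.
Proof.
have g0 : 0 < alpha + beta by rewrite ltr_wpDr.
apply/cvgryPge => A; pose B := Num.max 1 A.
have B0 : 0 < B by rewrite lt_max ltr01.
pose x0 := Num.max 1 (B `^ alpha^-1).
have := cvgr_idn (R := R) => /cvgryPge/(_ (x0 / (alpha + beta))).
move=> [N _ NP]; exists N.+1 => // -[|k]//= Nk.
have := NP k.+1 (ltnW Nk); rewrite /= ler_pdivrMr// mulrC => kx.
apply: le_trans (gamma_ratio_ge halpha _); last first.
  by rewrite (le_trans _ kx)// le_max lexx.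
apply: (@le_trans _ _ (x0 `^ alpha)).
  apply: (@le_trans _ _ ((B `^ alpha^-1) `^ alpha)).
    rewrite -powRrM mulVf ?gt_eqF// powRr1 ?(ltW B0)//.
    by rewrite le_max lexx orbT.
  rewrite ge0_ler_powR ?nnegrE ?powR_ge0 ?(ltW a0)// le_max ?ler01//.
  by rewrite lexx orbT.
rewrite ge0_ler_powR ?nnegrE ?(ltW a0)//; first by rewrite le_max ler01.
by rewrite mulr_ge0// ltW.
Qed.

(** [(alpha + beta) * k] may lie below 1, where [gamma_ratio_ge] does not apply, so the argument is
    first shifted by 1. The shifted ratio is at least 1, and the shift costs a factor at least
    [1 - alpha / (alpha + 1)]. *)
Lemma caputo_mult_lbound :
  exists2 b : R, 0 < b & forall k, (0 < k)%N -> b <= caputo_mult k.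
Proof.
exists (1 - alpha / (alpha + 1)).
  by rewrite subr_gt0 ltr_pdivrMr ?mul1r ?ltrDl// addr_gt0.
case=> // k _; have ak := ge_alpha (ltn0Sn k).
rewrite /caputo_mult gamma_ratioD1//; set x := (alpha + beta) * _ in ak *.
have x0 : 0 < x by apply: lt_le_trans ak.
have b0 : 0 <= 1 - alpha / (alpha + 1).
  by rewrite subr_ge0 ler_pdivrMr ?mul1r ?lerDl// addr_gt0.
rewrite -[leLHS]mul1r ler_pM//.
  apply: le_trans (gamma_ratio_ge halpha _); last by rewrite lerDr ltW.
  apply: (@le_trans _ _ ((x + 1) `^ 0)); first by rewrite powRr0.
  by rewrite ler_powR ?lerDr ?(ltW x0) ?(ltW a0).
rewrite lerD2l lerN2 ler_pM2l// lef_pV2 ?posrE ?addr_gt0//.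
by rewrite lerD2r.
Qed.

Lemma caputo_mult_minimum : minimum_principle caputo_mult.
Proof.
apply: (@minimum_principle_lim _ _ (fun n => n%:R `^ alpha) alpha
  (alpha + beta)) => //.
- by rewrite a1 ltW.
- by rewrite ltr_wpDr.
- by case=> // k _; exact/gamma_ratio_lim/ge_alpha.
Qed.

Lemma eta2E : eta2 alpha beta = (caputo_mult 1)^-1.
Proof.
rewrite /eta2 /caputo_mult /gamma_ratio mulr1 invf_div.
by congr (Gamma _ / Gamma _); ring.
Qed.

(** The [j]-th factor is the inverse of [caputo_mult (j + 2)]; only [caputo_mult 1] is missing to
    form [ml_coef]. *)
Lemma kilbas_saigo_coef k :
  \prod_(0 <= j < k)
    (Gamma (alpha * (j%:R * (1 + beta / alpha) + (1 + 2 * beta / alpha)) + 1) /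
     Gamma (alpha * (j%:R * (1 + beta / alpha) + (1 + 2 * beta / alpha) + 1) + 1))
  = caputo_mult 1 * P k.+1.
Proof.
have an0 := lt0r_neq0 a0.
elim: k => [|k IH].
  rewrite big_geq// ml_coefS ml_coef0 mul1r mulfV//.
  by rewrite gt_eqF// caputo_mult_gt0.
rewrite big_nat_recr//= IH -mulrA [in RHS]ml_coefS; congr (_ * (_ * _)).
rewrite /caputo_mult /gamma_ratio invf_div -!(natr1 k.+1) -(natr1 k).
by congr (Gamma _ / Gamma _); field.
Qed.

(** [eta2] supplies the missing first factor: [eta2] times the Kilbas-Saigo series at [- z] is
    [(1 - y(z)) / z]. The powers of [l] then cancel and [sqrt (lam k)] appears squared. *)
Lemma sigmaE (l : R) (lam : nat -> R) k : 0 < l -> 0 < lam k ->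
  sigma alpha beta l lam k =
    (1 - ml_fun caputo_mult (Num.sqrt (lam k) * l `^ (alpha + beta))) / lam k.
Proof.
move=> l0 lk0; set L := l `^ (alpha + beta); set s := Num.sqrt (lam k).
have L0 : 0 < L by exact: powR_gt0.
have s0 : 0 < s by rewrite sqrtr_gt0.
set z := s * L; have z0 : 0 < z by rewrite mulr_gt0.
have Phi1 := caputo_mult_gt0 (ltn0Sn 0).
set y := ml_fun _ _.
have cy : (ml_poly caputo_mult N.+2).[z] @[N --> \oo] --> y.
  rewrite (cvg_shiftS (fun N => (ml_poly caputo_mult N.+1).[z])).
  rewrite (cvg_shiftS (fun N => (ml_poly caputo_mult N).[z])).
  exact: is_cvg_ml_poly caputo_mult_gt0 caputo_mult_cvgy z.
rewrite /sigma eta2E -/L -/s -/z /kilbas_saigo.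
set u := (X in limn X).
(* Division by [z] lowers degrees by one: the sum up to degree [N] matches the truncation up to
   degree [N + 1]. *)
have uE N : u N.+1 = (1 - (ml_poly caputo_mult N.+2).[z]) *
    caputo_mult 1 / z - 1.
  rewrite /u; under eq_bigr do rewrite kilbas_saigo_coef.
  have zn := lt0r_neq0 z0; have Pn := lt0r_neq0 Phi1.
  elim: N => [|N IH].
    rewrite big_geq// !horner_ml_polyS horner_poly big_ord0 ml_coefS ml_coef0.
    by rewrite !expr0 !expr1 add0r; field; rewrite zn Pn.
  rewrite big_nat_recr// IH; set Q := caputo_mult 1; rewrite /= [in RHS]horner_ml_polyS -[(- z)]mulN1r exprMn.
  rewrite [(-1) ^+ N.+2]exprS [z ^+ N.+2]exprS.
  by field; rewrite zn.
have -> : limn u = (1 - y) * caputo_mult 1 / z - 1.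
  apply: cvg_lim => //; rewrite -cvg_shiftS.
  rewrite (_ : [sequence u N.+1]_N = (fun N =>
    (1 - (ml_poly caputo_mult N.+2).[z]) * caputo_mult 1 / z - 1)); last first.
    by apply/funext => N; exact: uE.
  apply: cvgB; last exact: cvg_cst.
  apply: cvgMl; apply: cvgMl.
  by apply: cvgB; [exact: cvg_cst|].
have lkE : lam k = s * s by rewrite -expr2 sqr_sqrtr// ltW.
rewrite lkE /z; have := (lt0r_neq0 s0, lt0r_neq0 L0, lt0r_neq0 Phi1).
by case=> -[? ?] ?; field; do !(apply/andP; split).
Qed.

Lemma sigma_ge (l : R) (lam : nat -> R) : 0 < l -> 0 < lam 0%N ->
  {homo lam : k k' / (k <= k')%N >-> k <= k'} ->
  exists2 c : R, 0 < c & forall k, c / lam k <= sigma alpha beta l lam k.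
Proof.
move=> l0 lam0 lamH; have [b b0 bP] := caputo_mult_lbound.
have L0 : 0 < l `^ (alpha + beta) by exact: powR_gt0.
pose z0 := Num.sqrt (lam 0%N) * l `^ (alpha + beta).
have z00 : 0 < z0 by rewrite mulr_gt0// sqrtr_gt0.
have [c c0 cP] := ml_fun_lt1 (erefl _) caputo_mult_gt0 caputo_mult_minimum
  caputo_mult_cvgy b0 bP z00.
exists c => // k; have lk0 : 0 < lam k by rewrite (lt_le_trans lam0)// lamH.
rewrite sigmaE// ler_pM2r ?invr_gt0// lerBrDr addrC -lerBrDr.
apply: cP; rewrite ler_pM2r// ler_sqrt ?(ltW lk0)//; exact: lamH.
Qed.

End sigma_lower_bound.

(** * Lebesgue measurability of open sets *)

Section open_sets_measurable.
Variables (R : realType) (n : nat).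
Local Notation V := 'rV[R]_n.+1.
Implicit Types (c : V * V) (i : 'I_n.+1) (t : R).

Definition upd (v : V) i t : V := \row_j (if j == i then t else v ord0 j).

Definition box_below i t c : V * V := (c.1, upd c.2 i (Num.min (c.2 ord0 i) t)).

Definition box_above i t c : V * V := (upd c.1 i (Num.max (c.1 ord0 i) t), c.2).

Lemma box_volume_split i t c :
  box_volume c = box_volume (box_below i t c) + box_volume (box_above i t c).
Proof.
rewrite /box_volume (bigD1 i)//= [X in _ = X + _](bigD1 i)//=.
rewrite [X in _ = _ + X](bigD1 i)//= !mxE eqxx.
set p := \prod_(j | j != i) _.
have -> : \prod_(j < n.+1 | j != i) Num.max 0
  (upd c.2 i (Num.min (c.2 ord0 i) t) ord0 j - c.1 ord0 j) = p.
  by apply: eq_bigr => j ji; rewrite mxE (negPf ji).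
have -> : \prod_(j < n.+1 | j != i) Num.max 0
  (c.2 ord0 j - upd c.1 i (Num.max (c.1 ord0 i) t) ord0 j) = p.
  by apply: eq_bigr => j ji; rewrite mxE (negPf ji).
rewrite -mulrDl; congr (_ * p).
move: (c.1 ord0 i) (c.2 ord0 i) => a b.
by case: (leP b t) => ?; case: (leP a t) => ?;
  case: (leP 0 (b - a)) => ?; do 2?[case: leP => ?]; lra.
Qed.

Lemma sub_box_below i t c :
  box c `&` [set x : V | x ord0 i < t] `<=` box (box_below i t c).
Proof.
move=> x [cx /= xt] j; rewrite /= mxE; have /andP[-> ?] := cx j.
by case: eqP => [->|//]; rewrite lt_min xt andbT; have /andP[] := cx i.
Qed.

Lemma sub_box_above i t c :
  box c `&` ~` [set x : V | x ord0 i < t] `<=` box (box_above i t c).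
Proof.
move=> x [cx /= /negP]; rewrite -leNgt => tx j; rewrite /= mxE.
have /andP[? ->] := cx j; rewrite andbT.
by case: eqP => [->|//]; rewrite ge_max tx andbT; have /andP[] := cx i.
Qed.

(** Caratheodory's criterion: cutting each box of a cover along the hyperplane yields covers of both
    parts, with the same total volume. *)
Lemma measurable_halfspace i t :
  measurable ([set x : V | x ord0 i < t] : set (Leb R n)).
Proof.
apply: le_caratheodory_measurable => X; set H := [set x | _].
apply: le_ereal_inf_tmp => _ [c cX <-].
apply: (@le_trans _ _ (\sum_(k <oo) (box_volume (box_below i t (c k)))%:E +
    \sum_(k <oo) (box_volume (box_above i t (c k)))%:E)%E).
  apply: leeD; apply: ereal_inf_lbound.
    exists (fun k => box_below i t (c k)) => // x [/cX[k _ ckx] Hx].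
    by exists k => //; apply: sub_box_below.
  exists (fun k => box_above i t (c k)) => // x [/cX[k _ ckx] Hx].
  by exists k => //; apply: sub_box_above.
rewrite -nneseriesD; [|by move=> k _ _; rewrite lee_fin box_volume_ge0..].
rewrite le_eqVlt; apply/orP; left; apply/eqP; apply: eq_eseriesr => k _.
by rewrite -EFinD -box_volume_split.
Qed.

Lemma measurable_box c : measurable (box c : set (Leb R n)).
Proof.
rewrite (_ : box c = \bigcap_(i in [set: 'I_n.+1])
    ([set x | x ord0 i < c.2 ord0 i] `&` ~` [set x | x ord0 i < c.1 ord0 i])).
  apply: fin_bigcap_measurable => // i _; apply: measurableI.
    exact: measurable_halfspace.
  by apply: measurableC; exact: measurable_halfspace.
apply/seteqP; split => x /= cx i.
  have /andP[c1 c2] := cx i; move=> _ /=; split => //.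
  by apply/negP; rewrite -leNgt.
by have [/= -> /negP] := cx i I; rewrite -leNgt => ->.
Qed.

(** An open set is the union of the rational boxes that it contains, and these are countably
    many. *)
Lemma open_measurable_Leb (A : set V) : open A ->
  measurable (A : set (Leb R n)).
Proof.
move=> oA; pose W := ('rV[rat]_n.+1 * 'rV[rat]_n.+1)%type.
pose B (w : W) : V * V := (map_mx ratr w.1, map_mx ratr w.2).
pose F (w : W) : set V := if pselect (box (B w) `<=` A) then box (B w) else set0.
have -> : A = \bigcup_w F w.
  apply/seteqP; split => [x Ax|x [w _]]; last first.
    by rewrite /F; case: pselect => // wA; exact: wA.
  have /nbhs_ballP[e /= e0 xeA] : nbhs x A by exact: open_nbhs_nbhs.
  have lo i : {q : rat | ratr q \in `](x ord0 i - e), (x ord0 i)[}.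
    by apply/cid/rat_in_itvoo; rewrite ltrBlDr ltrDl.
  have hi i : {q : rat | ratr q \in `](x ord0 i), (x ord0 i + e)[}.
    by apply/cid/rat_in_itvoo; rewrite ltrDl.
  exists (\row_i projT1 (lo i), \row_i projT1 (hi i)) => //.
  rewrite /F; case: pselect => [bA|[]] /=.
    move=> i; rewrite /B/= !mxE.
    have := projT2 (lo i); have := projT2 (hi i); rewrite !in_itv/=.
    by move=> /andP[? _] /andP[_ /ltW ?]; apply/andP.
  move=> y By; apply: xeA; split=> // j i; rewrite ord1 /ball/=.
  have := By i; rewrite /B/= !mxE.
  have := projT2 (lo i); have := projT2 (hi i); rewrite !in_itv/=.
  move=> /andP[? ?] /andP[? ?] /andP[? ?].
  by rewrite ltr_norml; apply/andP; split; lra.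
apply: countable_bigcupT_measurable => [|w]; first exact: countableP.
rewrite /F; case: pselect => [bA|nbA]; last exact: measurable0.
exact: measurable_box.
Qed.

End open_sets_measurable.

(** * The semi-inner product of L^2 *)

Section L2_theory.
Variables (R : realType) (n : nat) (Om : set 'rV[R]_n.+1).
Hypothesis mOm : measurable (Om : set (Leb R n)).
Local Notation V := 'rV[R]_n.+1.
Local Notation ip := (L2_inner Om).
Local Notation norm := (L2_norm Om).
Implicit Types u v w : V -> R.

Lemma L2P u : L2 Om u <->
  measurable_fun (Om : set (Leb R n)) (u : Leb R n -> R) /\
  leb.-integrable (Om : set (Leb R n))
    (EFin \o (fun x : Leb R n => u x * u x)).
Proof.
split=> -[mu iu]; split => //.
  apply/integrableP; split.
    by apply/measurable_EFinP; exact: measurable_funM.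
  apply: le_lt_trans iu; rewrite le_eqVlt; apply/orP; left; apply/eqP.
  by apply: eq_integral => x _; rewrite /= ger0_norm -expr2// sqr_ge0.
case/integrableP: iu => _; apply: le_lt_trans.
rewrite le_eqVlt; apply/orP; left; apply/eqP.
by apply: eq_integral => x _; rewrite /= ger0_norm -expr2// sqr_ge0.
Qed.

Lemma L2_integrableM u v : L2 Om u -> L2 Om v ->
  leb.-integrable (Om : set (Leb R n))
    (EFin \o (fun x : Leb R n => u x * v x)).
Proof.
move=> /L2P[mu iu] /L2P[mv iv].
apply: (le_integrable mOm _ _ (integrable_EFinD mOm iu iv)).
  by apply/measurable_EFinP; exact: measurable_funM.
move=> x _ /=; rewrite lee_fin normrM.
rewrite [leRHS]ger0_norm; last by rewrite addr_ge0// -expr2 sqr_ge0.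
rewrite -!expr2 -(real_normK (num_real (u x))) -(real_normK (num_real (v x))).
have := sqr_ge0 (`|u x| - `|v x|); have := normr_ge0 (u x).
have := normr_ge0 (v x); move: `|u x| `|v x| => a b; nra.
Qed.

Lemma L2D u v : L2 Om u -> L2 Om v -> L2 Om (fun x => u x + v x).
Proof.
move=> Lu Lv; have [[mu _] [mv _]] := (Lu, Lv).
apply/L2P; split; first exact: measurable_funD.
have -> : (fun x : Leb R n => (u x + v x) * (u x + v x)) =
    (fun x => (u x * u x + u x * v x) + (v x * u x + v x * v x)).
  by apply/funext => x; ring.
by apply: (integrable_EFinD mOm); apply: (integrable_EFinD mOm);
  exact: L2_integrableM.
Qed.

Lemma L2Z a u : L2 Om u -> L2 Om (fun x => a * u x).
Proof.
move=> Lu; have [mu _] := Lu; apply/L2P; split; first exact: measurable_funM.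
have -> : (fun x : Leb R n => (a * u x) * (a * u x)) =
    (fun x => a ^+ 2 * (u x * u x)).
  by apply/funext => x; ring.
by apply: (integrable_EFinZ mOm); exact: L2_integrableM.
Qed.

Lemma L2B u v : L2 Om u -> L2 Om v -> L2 Om (fun x => u x - v x).
Proof.
move=> Lu Lv; have -> : (fun x => u x - v x) = (fun x => u x + -1 * v x).
  by apply/funext => x; rewrite mulN1r.
exact: L2D Lu (L2Z (-1) Lv).
Qed.

Lemma ipC u v : ip u v = ip v u.
Proof. by apply: eq_Rintegral => x _; rewrite mulrC. Qed.

Lemma ipD u v w : L2 Om u -> L2 Om v -> L2 Om w ->
  ip (fun x => u x + v x) w = ip u w + ip v w.
Proof.
move=> Lu Lv Lw; rewrite /L2_inner -RintegralD//; try exact: L2_integrableM.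
by apply: eq_Rintegral => x _; rewrite mulrDl.
Qed.

Lemma ipZ a u v : L2 Om u -> L2 Om v -> ip (fun x => a * u x) v = a * ip u v.
Proof.
move=> Lu Lv; rewrite /L2_inner -RintegralZl//; try exact: L2_integrableM.
by apply: eq_Rintegral => x _; rewrite mulrA.
Qed.

Lemma ipB u v w : L2 Om u -> L2 Om v -> L2 Om w ->
  ip (fun x => u x - v x) w = ip u w - ip v w.
Proof.
move=> Lu Lv Lw; rewrite /L2_inner -RintegralB//; try exact: L2_integrableM.
by apply: eq_Rintegral => x _; rewrite mulrBl.
Qed.

Lemma ip_ge0 u : 0 <= ip u u.
Proof. by apply: Rintegral_ge0 => x _; rewrite -expr2 sqr_ge0. Qed.

Lemma L2_norm_ge0 u : 0 <= norm u.
Proof. exact: sqrtr_ge0. Qed.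

Lemma sqr_L2_norm u : norm u ^+ 2 = ip u u.
Proof. by rewrite sqr_sqrtr ?ip_ge0. Qed.

Lemma L2_cauchy_schwarz u v : L2 Om u -> L2 Om v ->
  `|ip u v| <= norm u * norm v.
Proof.
move=> Lu Lv.
have H s t : 0 <= s ^+ 2 * ip u u - 2 * s * t * ip u v + t ^+ 2 * ip v v.
  have := ip_ge0 (fun x => s * u x - t * v x).
  have [Lsu Ltv] := (L2Z s Lu, L2Z t Lv).
  have Lst := L2B Lsu Ltv.
  rewrite (ipB Lsu Ltv Lst) (ipZ s Lu Lst) (ipZ t Lv Lst) ipC [ip v _]ipC.
  rewrite (ipB Lsu Ltv Lu) (ipB Lsu Ltv Lv) (ipZ s Lu Lu) (ipZ t Lv Lu).
  rewrite (ipZ s Lu Lv) (ipZ t Lv Lv) (ipC v u); nra.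
rewrite -(@ler_pXn2r _ 2)//; [|by rewrite nnegrE ?normr_ge0 ?mulr_ge0 ?L2_norm_ge0..].
rewrite real_normK ?num_real// exprMn !sqr_L2_norm.
have [vv0|vv0] := eqVneq (ip v v) 0; last first.
  have vvp : 0 < ip v v by rewrite lt_neqAle eq_sym vv0 ip_ge0.
  rewrite -subr_ge0 -(pmulr_rge0 _ vvp).
  by have := H (ip v v) (ip u v); congr (0 <= _); ring.
have [->|uv0] := eqVneq (ip u v) 0; first by rewrite expr0n vv0 mulr0.
(* If [v] has norm 0 but [ip u v] is nonzero, this choice turns the nonnegative quadratic form into
   -1. *)
have := H 1 ((ip u u + 1) / (2 * ip u v)); rewrite vv0 expr1n mul1r mulr0 addr0.
have -> : 2 * 1 * ((ip u u + 1) / (2 * ip u v)) * ip u v = ip u u + 1 by field.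
lra.
Qed.

Lemma L2_norm_triangle u v : L2 Om u -> L2 Om v ->
  norm (fun x => u x + v x) <= norm u + norm v.
Proof.
move=> Lu Lv.
rewrite -(@ler_pXn2r _ 2)//; [|by rewrite nnegrE ?addr_ge0 ?L2_norm_ge0..].
rewrite sqr_L2_norm (ipD Lu Lv (L2D Lu Lv)) ![ip _ (fun x => _ + _)]ipC.
rewrite (ipD Lu Lv Lu) (ipD Lu Lv Lv) sqrrD !sqr_L2_norm (ipC v u).
have := L2_cauchy_schwarz Lu Lv; have := ler_norm (ip u v); lra.
Qed.

Lemma L2_normN u : norm (fun x => - u x) = norm u.
Proof.
by congr (Num.sqrt _); apply: eq_Rintegral => x _; rewrite mulrNN.
Qed.

Lemma L2_norm_distC u v : norm (fun x => u x - v x) = norm (fun x => v x - u x).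
Proof.
by rewrite -L2_normN; congr norm; apply/funext => x; rewrite opprB.
Qed.

End L2_theory.

(** * Orthonormal expansions *)

Section orthonormal_expansion.
Variables (R : realType) (n : nat) (Om : set 'rV[R]_n.+1).
Hypothesis mOm : measurable (Om : set (Leb R n)).
Local Notation V := 'rV[R]_n.+1.
Local Notation ip := (L2_inner Om).
Local Notation norm := (L2_norm Om).
Variable phi : nat -> V -> R.
Hypothesis Lphi : forall k, L2 Om (phi k).
Hypothesis phi_on : forall k k', ip (phi k) (phi k') = (k == k')%:R.
Implicit Types (a b m : nat -> R) (u v e g : V -> R).

Definition phi_comb a N : V -> R := fun x => \sum_(k < N) a k * phi k x.

Lemma L2_phi_comb a N : L2 Om (phi_comb a N).
Proof.
elim: N => [|N IH].
  have -> : phi_comb a 0 = (fun x => 0 * phi 0%N x).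
    by apply/funext => x; rewrite /phi_comb big_ord0 mul0r.
  exact: L2Z.
have -> : phi_comb a N.+1 = (fun x => phi_comb a N x + a N * phi N x).
  by apply/funext => x; rewrite /phi_comb big_ord_recr.
exact: (L2D mOm IH (L2Z mOm (a N) (Lphi N))).
Qed.

Lemma ip_phi_comb a N u : L2 Om u ->
  ip (phi_comb a N) u = \sum_(k < N) a k * ip (phi k) u.
Proof.
move=> Lu; elim: N => [|N IH].
  have -> : phi_comb a 0 = (fun x => 0 * phi 0%N x).
    by apply/funext => x; rewrite /phi_comb big_ord0 mul0r.
  by rewrite (ipZ mOm 0 (Lphi 0%N) Lu) mul0r big_ord0.
have -> : phi_comb a N.+1 = (fun x => phi_comb a N x + a N * phi N x).
  by apply/funext => x; rewrite /phi_comb big_ord_recr.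
rewrite (ipD mOm (L2_phi_comb a N) (L2Z mOm (a N) (Lphi N)) Lu).
by rewrite IH (ipZ mOm (a N) (Lphi N) Lu) big_ord_recr.
Qed.

Lemma ip_phi_comb_phi a N k : (k < N)%N -> ip (phi_comb a N) (phi k) = a k.
Proof.
move=> kN; rewrite (ip_phi_comb _ _ (Lphi k)) (bigD1 (Ordinal kN))//= phi_on eqxx mulr1.
rewrite big1 ?addr0// => i ik; rewrite phi_on.
by move: ik; rewrite -val_eqE => /negPf /= ->; rewrite mulr0.
Qed.

Lemma sqr_norm_phi_comb a N :
  norm (phi_comb a N) ^+ 2 = \sum_(k < N) a k ^+ 2.
Proof.
rewrite sqr_L2_norm (ip_phi_comb _ _ (L2_phi_comb a N)).
by apply: eq_bigr => k _; rewrite ipC ip_phi_comb_phi.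
Qed.

Lemma bessel e N : L2 Om e -> \sum_(k < N) ip e (phi k) ^+ 2 <= norm e ^+ 2.
Proof.
move=> Le; set a := fun k => ip e (phi k).
have La := L2_phi_comb a N.
have := ip_ge0 Om (fun x => e x - phi_comb a N x).
rewrite (ipB mOm Le La (L2B mOm Le La)) [ip e _]ipC [X in _ - X]ipC.
rewrite (ipB mOm Le La Le) (ipB mOm Le La La).
rewrite -!sqr_L2_norm sqr_norm_phi_comb (ipC _ e) (ip_phi_comb _ _ Le).
have -> : \sum_(k < N) a k * ip (phi k) e = \sum_(k < N) a k ^+ 2.
  by apply: eq_bigr => k _; rewrite ipC.
by rewrite subrr subr0 subr_ge0.
Qed.

(** For [N > k] the partial sum already has the claimed coefficient, and by Cauchy-Schwarz the
    coefficient of the remainder is at most its norm, which tends to 0. *)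
Lemma spectral_sum_coef m u v k : spectral_sum Om phi m u v ->
  ip v (phi k) = m k * ip u (phi k).
Proof.
move=> [Lv cv]; apply/eqP; rewrite -subr_eq0 -normr_le0.
apply: cvgr_to_ge cv _; exists k.+1 => // N /= kN.
have Ls := L2_phi_comb (fun k => m k * ip u (phi k)) N.
have := L2_cauchy_schwarz mOm (L2B mOm Lv Ls) (Lphi k).
have -> : norm (phi k) = 1 by rewrite /L2_norm phi_on eqxx sqrtr1.
by rewrite (ipB mOm Lv Ls (Lphi k)) ip_phi_comb_phi// mulr1.
Qed.

(** Triangle inequality through the two partial sums: the tails tend to 0, and orthonormality
    computes the distance between the partial sums. *)
Lemma spectral_sum_dist_le m m' u u' v v' (K : R) : 0 <= K ->
  spectral_sum Om phi m u v -> spectral_sum Om phi m' u' v' ->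
  (forall N, \sum_(k < N) (m k * ip u (phi k) - m' k * ip u' (phi k)) ^+ 2
    <= K ^+ 2) ->
  norm (fun x => v x - v' x) <= K.
Proof.
move=> K0 [Lv cv] [Lv' cv'] HK.
pose a k := m k * ip u (phi k); pose b k := m' k * ip u' (phi k).
have cvv := cvgD cv cv'; rewrite addr0 in cvv.
have {}cvv : norm (fun x => v x - phi_comb a N x) +
    norm (fun x => v' x - phi_comb b N x) + K @[N --> \oo] --> 0 + K.
  by apply: cvgD; [exact: cvv|exact: cvg_cst].
rewrite -[leRHS]add0r; apply: cvgr_to_ge cvv _; apply: nearW => N.
have [La Lb] := (L2_phi_comb a N, L2_phi_comb b N).
have Lab := L2B mOm La Lb; have Lva := L2B mOm Lv La; have Lvb := L2B mOm Lb Lv'.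
have -> : (fun x => v x - v' x) = (fun x => (v x - phi_comb a N x) +
    ((phi_comb b N x - v' x) + (phi_comb a N x - phi_comb b N x))).
  by apply/funext => x; ring.
apply: (le_trans (L2_norm_triangle mOm Lva (L2D mOm Lvb Lab))).
rewrite -addrA lerD2l; apply: (le_trans (L2_norm_triangle mOm Lvb Lab)).
rewrite L2_norm_distC lerD2l.
rewrite -(@ler_pXn2r _ 2)//; [|by rewrite nnegrE ?L2_norm_ge0..].
apply: le_trans (HK N).
have -> : (fun x => phi_comb a N x - phi_comb b N x) =
    phi_comb (fun k => a k - b k) N.
  apply/funext => x; rewrite /phi_comb -sumrB.
  by apply: eq_bigr => k _; rewrite mulrBl.
by rewrite sqr_norm_phi_comb.
Qed.

Lemma weighted_sum_le w g N : (forall k, 0 <= w k) ->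
  weighted_dom Om phi w g ->
  \sum_(k < N) w k * ip g (phi k) ^+ 2 <= weighted_norm Om phi w g ^+ 2.
Proof.
move=> w0 [_ cw]; set s := weighted_series Om phi w g in cw *.
have s0 k : 0 <= w k * `|ip g (phi k)| ^+ 2 by rewrite mulr_ge0 ?sqr_ge0.
have sN N' : s N' <= limn s.
  apply: nondecreasing_cvgn_le cw _; exact: nondecreasing_series.
rewrite sqr_sqrtr; last first.
  by apply: le_trans (sN 0%N); exact: sumr_ge0.
apply: le_trans (sN N); rewrite /s /weighted_series /series/= big_mkord.
by apply: ler_sum => k _; rewrite real_normK ?num_real.
Qed.

(* [m] is the filter applied to the noisy data [K g + e]. *)
Lemma regularization_error m s w (A B delta : R) u Kg e g gt :
  (forall v, L2 Om v -> spectral_sum Om phi (fun=> 1) v v) ->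
  0 <= A -> 0 <= B ->
  (forall k, 0 <= w k) ->
  (forall k, `|m k| <= A) ->
  (forall k, (m k * s k - 1) ^+ 2 <= B ^+ 2 * w k) ->
  L2 Om e -> norm e <= delta -> u = (fun x => Kg x + e x) ->
  spectral_sum Om phi s g Kg -> spectral_sum Om phi m u gt ->
  weighted_dom Om phi w g ->
  norm (fun x => gt x - g x) <= 2 * (A * delta + B * weighted_norm Om phi w g).
Proof.
move=> complete A0 B0 w0 mA mB Le ed uE sKg su wg.
have d0 : 0 <= delta by apply: le_trans ed; exact: L2_norm_ge0.
have W0 : 0 <= weighted_norm Om phi w g by exact: sqrtr_ge0.
have [Lg _] := wg; have [LKg _] := sKg.
apply: (spectral_sum_dist_le _ su (complete _ Lg)) => [|N].
  by rewrite mulr_ge0// addr_ge0// mulr_ge0.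
apply: (@le_trans _ _ (\sum_(k < N) (2 * A ^+ 2 * ip e (phi k) ^+ 2 +
    2 * B ^+ 2 * (w k * ip g (phi k) ^+ 2)))).
  apply: ler_sum => k _; rewrite uE (ipD mOm LKg Le (Lphi k)) (spectral_sum_coef k sKg) mul1r.
  set ek := ip e _; set gk := ip g _.
  (* The error splits into amplified noise, controlled by [A] and Bessel's inequality, and
     regularization bias, controlled by [B] and the source condition. *)
  have -> : m k * (s k * gk + ek) - gk = m k * ek + (m k * s k - 1) * gk by ring.
  apply: (@le_trans _ _ (2 * (m k * ek) ^+ 2 + 2 * ((m k * s k - 1) * gk) ^+ 2)).
    have := sqr_ge0 (m k * ek - (m k * s k - 1) * gk).
    move: (m k * ek) (_ * gk) => p q; nra.
  apply: lerD; rewrite -[leRHS]mulrA ler_pM2l// exprMn.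
    rewrite ler_wpM2r ?sqr_ge0// -(real_normK (num_real (m k))).
    by rewrite lerXn2r ?nnegrE.
  by rewrite [leRHS]mulrA ler_wpM2r ?sqr_ge0.
rewrite big_split/= -!mulr_sumr.
have b1 := bessel N Le; have b2 := weighted_sum_le N w0 wg.
apply: (@le_trans _ _ (2 * A ^+ 2 * delta ^+ 2 +
    2 * B ^+ 2 * weighted_norm Om phi w g ^+ 2)).
  rewrite lerD// ler_wpM2l ?mulr_ge0 ?sqr_ge0//.
  by apply: le_trans b1 _; rewrite lerXn2r ?nnegrE ?L2_norm_ge0.
have := mulr_ge0 A0 d0; have := mulr_ge0 B0 W0.
set W := weighted_norm _ _ _ _.
have -> : 2 * A ^+ 2 * delta ^+ 2 = 2 * (A * delta) ^+ 2 by ring.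
have -> : 2 * B ^+ 2 * W ^+ 2 = 2 * (B * W) ^+ 2 by ring.
by move: (A * delta) (B * W) => p q; nra.
Qed.

End orthonormal_expansion.

(** * Error estimates *)

Section filter_bounds.
Variable R : realType.
Implicit Types a b c e s tau x y lambda r : R.

Lemma powR_mean_le x y a : 0 < x -> 0 < y -> 0 <= a <= 1 ->
  x `^ a * y `^ (1 - a) <= x + y.
Proof.
move=> x0 y0 /andP[a0 a1]; have xy0 : 0 < x + y by rewrite addr_gt0.
have -> : x + y = (x + y) `^ a * (x + y) `^ (1 - a).
  by rewrite -powRD ?(gt_eqF xy0) ?implybT// [a + _]addrC subrK powRr1// ltW.
rewrite ler_pM ?powR_ge0// ge0_ler_powR ?nnegrE ?subr_ge0 ?(ltW x0) ?(ltW y0)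
  ?(ltW xy0)//.
  by rewrite lerDl ltW.
by rewrite lerDr ltW.
Qed.

(** The free exponent [a] trades growth in [lambda] against the negative power of [tau]. *)
Lemma filter_le c lambda s tau e a : 0 < c -> 0 < lambda -> 0 < tau -> 0 < e ->
  0 <= a <= 1 -> c / lambda <= s ->
  (s + tau * e)^-1 <= (lambda / c) `^ a * (tau * e) `^ (a - 1).
Proof.
move=> c0 l0 t0 e0 a01 cs.
have cl0 : 0 < c / lambda by rewrite divr_gt0.
have te0 : 0 < tau * e by rewrite mulr_gt0.
have -> : (lambda / c) `^ a * (tau * e) `^ (a - 1) =
    ((c / lambda) `^ a * (tau * e) `^ (1 - a))^-1.
  rewrite invfM -!powRN opprB; congr (_ * _).
  rewrite -[lambda / c]invf_div -[(_ / _)^-1]powR_inv1 ?(ltW cl0)//.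
  by rewrite -powRrM mulN1r.
rewrite lef_pV2 ?posrE; last 2 first.
- by rewrite addr_gt0// (lt_le_trans cl0).
- by rewrite mulr_gt0 ?powR_gt0.
by apply: le_trans (powR_mean_le cl0 te0 a01) _; rewrite lerD2r.
Qed.

Lemma filter_residual_le c lambda s tau e a :
  0 < c -> 0 < lambda -> 0 < tau -> 0 < e ->
  0 <= a <= 1 -> c / lambda <= s ->
  tau * e * (s + tau * e)^-1 <= (lambda / c * (tau * e)) `^ a.
Proof.
move=> c0 l0 t0 e0 a01 cs; have te0 : 0 < tau * e by rewrite mulr_gt0.
have := filter_le c0 l0 t0 e0 a01 cs; rewrite -(ler_pM2l te0) => /le_trans.
apply; rewrite mulrCA [leRHS]powRM ?divr_ge0 ?(ltW l0) ?(ltW c0) ?(ltW te0)//.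
rewrite ler_wpM2l ?powR_ge0// -{1}[tau * e]powRr1 ?(ltW te0)//.
by rewrite -powRD ?(gt_eqF te0) ?implybT// addrC subrK.
Qed.

(** [u <= exp u] at [u = (b r / a) lambda ^ r], raised to the power [a / r]. *)
Lemma powR_le_expR lambda r a b : 0 < lambda -> 0 < r -> 0 < a -> 0 < b ->
  lambda `^ a <= (b * r / a) `^ (- (a / r)) * expR (b * lambda `^ r).
Proof.
move=> l0 r0 a0 b0; have k0 : 0 < b * r / a by rewrite divr_gt0// mulr_gt0.
have ar0 : 0 < a / r by rewrite divr_gt0.
rewrite powRN ler_pdivlMl ?powR_gt0//.
have -> : lambda `^ a = (lambda `^ r) `^ (a / r).
  by rewrite -powRrM mulrC divfK// gt_eqF.
have -> : expR (b * lambda `^ r) = expR (b * r / a * lambda `^ r) `^ (a / r).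
  have := (lt0r_neq0 a0, lt0r_neq0 r0) => -[? ?].
  by rewrite -expRM; congr expR; field; do !(apply/andP; split).
rewrite -powRM ?powR_ge0 ?(ltW k0)// ge0_ler_powR ?nnegrE ?(ltW ar0)//.
- by rewrite mulr_ge0 ?powR_ge0 ?(ltW k0).
- by apply: le_trans (expR_ge1Dx _); rewrite lerDr.
Qed.

Lemma npowR_le x y r : 0 < x -> x <= y -> r <= 0 -> y `^ r <= x `^ r.
Proof.
move=> x0 xy r0; have y0 := lt_le_trans x0 xy.
rewrite -[r]opprK !(powRN _ (- r)) lef_pV2 ?posrE ?powR_gt0//.
by rewrite ge0_ler_powR ?nnegrE ?oppr_ge0 ?(ltW x0) ?(ltW y0).
Qed.

End filter_bounds.

(** * Convergence rates under the two source conditions *)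

Section error_estimate.
Variables (R : realType) (n : nat) (alpha beta l : R).
Hypotheses (halpha : 0 < alpha <= 1) (hbeta : 0 <= beta) (hl : 0 < l).
Variables (Om : set 'rV[R]_n.+1) (hOm : bounded_smooth_domain Om).
Variable L : ('rV[R]_n.+1 -> R) -> ('rV[R]_n.+1 -> R).
Variables (lam : nat -> R) (phi : nat -> 'rV[R]_n.+1 -> R).
Hypothesis hphi : eigensystem Om L lam phi.
Local Notation s := (sigma alpha beta l lam).
Local Notation e r k := (expR (lam k `^ r)).

Let lam_gt0 k : 0 < lam k.
Proof. by have [[lam0 lamH _] _ _ _] := hphi; rewrite (lt_le_trans lam0)// lamH. Qed.

Let lam_ge k : lam 0%N <= lam k.
Proof. by have [[_ lamH _] _ _ _] := hphi; exact: lamH. Qed.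

Let s_ge : exists2 c : R, 0 < c & forall k, c / lam k <= s k.
Proof. by have [[lam0 lamH _] _ _ _] := hphi; exact: sigma_ge. Qed.

Lemma filter_gt0 (tau r : R) k : 0 < tau -> 0 < s k + tau * e r k.
Proof.
move=> t0; have [c c0 cs] := s_ge; apply: addr_gt0.
  by rewrite (lt_le_trans _ (cs k))// divr_gt0.
by rewrite mulr_gt0// expR_gt0.
Qed.

(** Reduces each rate to two scalar bounds uniform in [k]: [A] for the filter and [B] for its
    residual relative to the square root of the source weight. *)
Lemma exp_qbv_error (w : nat -> R) (A B delta tau r : R)
    (f g F Kg hd gt : 'rV[R]_n.+1 -> R) :
  0 < tau -> 0 <= A -> 0 <= B ->
  (forall k, 0 <= w k) ->
  (forall k, (s k + tau * e r k)^-1 <= A) ->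
  (forall k, tau * e r k * (s k + tau * e r k)^-1 <= B * Num.sqrt (w k)) ->
  noisy_trace Om lam phi alpha beta l f g F Kg hd delta ->
  exp_qbv_solution Om lam phi alpha beta l tau r (F \- hd) gt ->
  weighted_dom Om phi w g ->
  L2_norm Om (gt \- g) <= 2 * (A * delta + B * weighted_norm Om phi w g).
Proof.
move=> t0 A0 B0 w0 mA mB [[_ Lg] sF sKg Lhd ehd] sgt wg.
have [_ Hphi phi_on complete] := hphi.
have mOm : measurable (Om : set (Leb R n)).
  by case: hOm => oOm _ _ _ _; exact: open_measurable_Leb.
have Lphi k : L2 Om (phi k) by have [[_ []]] := Hphi k.
have [LF _] := sF; have [LKg _] := sKg.
pose d x := F x - Kg x - hd x.
have Ld : L2 Om d by exact: (L2B mOm (L2B mOm LF LKg) Lhd).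
have dd : L2_norm Om d <= delta by rewrite /d L2_norm_distC.
have m0 k : 0 < (s k + tau * e r k)^-1 by rewrite invr_gt0 filter_gt0.
apply: (regularization_error mOm Lphi phi_on complete A0 B0 w0 _ _ Ld dd
  _ sKg sgt wg).
- by move=> k; rewrite gtr0_norm.
- move=> k; have mk := lt0r_neq0 (filter_gt0 r k t0).
  rewrite -[B ^+ 2 * _]mulr1 -[w k]sqr_sqrtr// mulr1 -exprMn.
  have -> : (s k + tau * e r k)^-1 * s k - 1 =
    - (tau * e r k * (s k + tau * e r k)^-1) by field.
  rewrite sqrrN lerXn2r ?nnegrE//.
    by rewrite !mulr_ge0 ?expR_ge0 ?(ltW t0) ?(ltW (m0 k)).
  by rewrite mulr_ge0 ?sqrtr_ge0.
- by apply/funext => x; rewrite /d/=; ring.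
Qed.

Lemma rate_le (A B delta W KA KB rho : R) : 0 <= W -> 0 <= rho ->
  0 < KA -> 0 < KB -> A * delta = KA * rho -> B = KB * rho ->
  2 * (A * delta + B * W) <= 2 * (KA + KB) * (1 + W) * rho.
Proof.
move=> W0 rho0 KA0 KB0 -> ->.
have : 0 <= KA * W * rho by rewrite !mulr_ge0// ltW.
have : 0 <= KB * rho by rewrite !mulr_ge0// ltW.
lra.
Qed.

(* To be used with [a] the minimum of [p] and [1]. *)
Lemma nonpos_rate (r p a : R) : r <= 0 -> 0 < a <= 1 -> a <= p ->
  exists2 C : R, 0 < C &
  forall (delta tau : R) (f g F Kg hd gt : 'rV[R]_n.+1 -> R),
    0 < delta ->
    noisy_trace Om lam phi alpha beta l f g F Kg hd delta ->
    exp_qbv_solution Om lam phi alpha beta l tau r (F \- hd) gt ->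
    frac_dom Om lam phi p g ->
    tau = delta `^ (1 / (a + 1)) ->
    L2_norm Om (gt \- g) <=
      C * (1 + frac_norm Om lam phi p g) * delta `^ (a / (a + 1)).
Proof.
move=> r0 /andP[a0 a1] ap; have [c c0 cs] := s_ge.
have a01 : 0 <= a <= 1 by rewrite ltW.
pose e0 := e r 0%N; have e00 : 0 < e0 by exact: expR_gt0.
have ee0 k : e r k <= e0 by rewrite ler_expR npowR_le.
have e1 k : 1 <= e r k by rewrite -expR0 ler_expR powR_ge0.
(* As [r <= 0], [e0] bounds all the exponentials. As [a <= p], [lam k ^ a] is at most
   [lam 0 ^ (a - p) * lam k ^ p]. *)
pose KB := (e0 / c) `^ a * lam 0%N `^ (a - p).
have KB0 : 0 < KB by rewrite mulr_gt0 ?powR_gt0 ?divr_gt0.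
exists (2 * (1 + KB)) => [|delta tau f g F Kg hd gt d0 hn hs hg tE].
  by rewrite mulr_gt0// addr_gt0.
have t0 : 0 < tau by rewrite tE powR_gt0.
have a10 : a + 1 != 0 by rewrite gt_eqF// addr_gt0.
(* The filter is at most [1 / tau] because the exponentials are at least 1; the choice of [tau]
   makes [delta / tau] equal to [tau ^ a]. *)
apply: le_trans (rate_le (A := tau^-1) (B := KB * tau `^ a) (delta := delta)
  (sqrtr_ge0 _) (powR_ge0 _ _) ltr01 KB0 _ _); last 2 first.
- rewrite mul1r tE -powRN -{2}[delta]powRr1 ?(ltW d0)// -powRD.
    by congr (_ `^ _); field.
  by rewrite (gt_eqF d0) implybT.
- by rewrite tE -powRrM; congr (_ * _ `^ _); field.
apply: (exp_qbv_error t0 _ _ _ _ _ hn hs hg).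
- by rewrite invr_ge0 ltW.
- by rewrite mulr_ge0 ?powR_ge0 ?(ltW KB0).
- by move=> k; exact: powR_ge0.
- move=> k; rewrite lef_pV2 ?posrE ?filter_gt0//.
  apply: (@le_trans _ _ (tau * e r k)); first by rewrite ler_peMr ?(ltW t0).
  by rewrite lerDr (le_trans _ (cs k))// divr_ge0// ltW.
- move=> k.
  have -> : Num.sqrt (frac_weight lam p k) = lam k `^ p.
    rewrite /frac_weight mulrC powRrM powR_mulrn ?powR_ge0//.
    by rewrite sqrtr_sqr ger0_norm ?powR_ge0.
  apply: le_trans
    (filter_residual_le c0 (lam_gt0 k) t0 (expR_gt0 _) a01 (cs k)) _.
  apply: (@le_trans _ _ ((e0 / c * tau * lam k) `^ a)).
    rewrite ge0_ler_powR ?nnegrE ?(ltW a0)//.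
    + by rewrite !mulr_ge0 ?invr_ge0 ?expR_ge0 ?(ltW t0) ?(ltW c0) ?(ltW (lam_gt0 k)).
    + by rewrite !mulr_ge0 ?invr_ge0 ?(ltW e00) ?(ltW t0) ?(ltW c0) ?(ltW (lam_gt0 k)).
    + rewrite (_ : _ / c * _ = e r k * (c^-1 * tau * lam k)); last by ring.
      rewrite (_ : e0 / c * _ * _ = e0 * (c^-1 * tau * lam k)); last by ring.
      by rewrite ler_wpM2r// !mulr_ge0 ?invr_ge0 ?(ltW c0) ?(ltW t0) ?(ltW (lam_gt0 k)).
  have ec0 : 0 <= e0 / c by rewrite divr_ge0 ?(ltW e00) ?(ltW c0).
  rewrite powRM ?(ltW (lam_gt0 k)) ?(mulr_ge0 ec0 (ltW t0))//.
  rewrite powRM ?(ltW t0)// /KB.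
  have -> : lam k `^ a = lam k `^ (a - p) * lam k `^ p.
    by rewrite -powRD ?(gt_eqF (lam_gt0 k)) ?implybT// subrK.
  rewrite mulrA ler_wpM2r ?powR_ge0// mulrAC ler_wpM2r ?powR_ge0//.
  by rewrite ler_wpM2l ?powR_ge0// npowR_le// subr_le0.
Qed.

(** Both filter bounds contain powers of [lam k], which the surplus exponential decay absorbs at the
    price of a constant. *)
Lemma pos_rate (r p : R) : 0 < r -> 1 < p ->
  exists2 C : R, 0 < C &
  forall (delta tau : R) (f g F Kg hd gt : 'rV[R]_n.+1 -> R),
    0 < delta ->
    noisy_trace Om lam phi alpha beta l f g F Kg hd delta ->
    exp_qbv_solution Om lam phi alpha beta l tau r (F \- hd) gt ->
    exp_dom Om lam phi r g ->
    tau = delta `^ ((p + 1) * (1 + r) / (p + r + 2)) ->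
    L2_norm Om (gt \- g) <=
      C * (1 + exp_norm Om lam phi r g) *
      delta `^ ((1 + r) / (p + r + 2)).
Proof.
move=> r0 p1; have [c c0 cs] := s_ge.
have p0 : 0 < p by rewrite (lt_trans ltr01).
have r10 : 0 < 1 + r by rewrite addr_gt0.
have p10 : 0 < p + 1 by rewrite addr_gt0.
have K0 (a b : R) : 0 < a -> 0 < b ->
    exists2 K, 0 < K & forall k, (lam k / c) `^ a <= K * expR (b * lam k `^ r).
  move=> a0 b0; exists (c `^ (- a) * (b * r / a) `^ (- (a / r))).
    by rewrite mulr_gt0 ?powR_gt0// divr_gt0// mulr_gt0.
  move=> k; rewrite powRM ?invr_ge0 ?(ltW c0) ?(ltW (lam_gt0 k))// mulrC -[leRHS]mulrA.
  rewrite -(powR_inv1 (ltW c0)) -powRrM mulN1r ler_wpM2l ?powR_ge0//.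
  exact: powR_le_expR.
(* These exponents give noise [delta * tau ^ (- 1 / (1 + r))] and bias [tau ^ (1 / (p + 1))], which
   the choice of [tau] equalizes. As [p > 1], [a2 < 1/2], so part of the weight
   [exp (lam k ^ r / 2)] is left to absorb [lam k ^ a2]. *)
pose a1 := r / (1 + r); pose a2 := 1 / (p + 1).
have a10 : 0 < a1 by rewrite divr_gt0.
have a11 : a1 < 1 by rewrite ltr_pdivrMr// mul1r ltrDr.
have a20 : 0 < a2 by rewrite divr_gt0.
have a22 : a2 < 2^-1 by rewrite ltr_pdivrMr// ltr_pdivlMl//; lra.
have b10 : 0 < 1 - a1 by rewrite subr_gt0.
have b20 : 0 < 2^-1 - a2 by rewrite subr_gt0.
have [K1 K10 K1P] := K0 _ _ a10 b10.
have [K2 K20 K2P] := K0 _ _ a20 b20.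
exists (2 * (K1 + K2)) => [|delta tau f g F Kg hd gt d0 hn hs hg tE].
  by rewrite mulr_gt0// addr_gt0.
have t0 : 0 < tau by rewrite tE powR_gt0.
have pr0 : p + r + 2 != 0 by rewrite gt_eqF// !addr_gt0.
have r1n := lt0r_neq0 r10; have p1n := lt0r_neq0 p10.
apply: le_trans (rate_le (A := K1 * tau `^ (a1 - 1)) (B := K2 * tau `^ a2)
  (delta := delta) (sqrtr_ge0 _) (powR_ge0 _ _) K10 K20 _ _); last 2 first.
- rewrite -mulrA; congr (_ * _).
  rewrite tE -powRrM -{2}[delta]powRr1 ?(ltW d0)// -powRD.
    by congr (_ `^ _); rewrite /a1; field; rewrite r1n pr0.
  by rewrite (gt_eqF d0) implybT.
- rewrite tE -powRrM; congr (_ * _ `^ _).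
  by rewrite /a2; field; rewrite p1n pr0.
have powe (x : R) k : e r k `^ x = expR (x * lam k `^ r) by rewrite mulrC expRM.
apply: (exp_qbv_error t0 _ _ _ _ _ hn hs hg).
- by rewrite mulr_ge0 ?powR_ge0 ?(ltW K10).
- by rewrite mulr_ge0 ?powR_ge0 ?(ltW K20).
- by move=> k; exact: expR_ge0.
- move=> k; have a01 : 0 <= a1 <= 1 by rewrite !ltW.
  apply: le_trans (filter_le c0 (lam_gt0 k) t0 (expR_gt0 _) a01 (cs k)) _.
  rewrite (@powRM _ tau) ?expR_ge0 ?(ltW t0)// mulrCA [K1 * _]mulrC.
  rewrite ler_wpM2l ?powR_ge0//.
  rewrite powe -[a1 - 1]opprB mulNr expRN ler_pdivrMr ?expR_gt0//.
- move=> k; have a01 : 0 <= a2 <= 1 by rewrite ltW//= (le_trans (ltW a22))//; lra.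
  apply: le_trans
    (filter_residual_le c0 (lam_gt0 k) t0 (expR_gt0 _) a01 (cs k)) _.
  have te0 : 0 <= tau * e r k by rewrite mulr_ge0 ?expR_ge0 ?(ltW t0).
  rewrite powRM ?divr_ge0 ?(ltW c0) ?(ltW (lam_gt0 k))//.
  rewrite (@powRM _ tau) ?expR_ge0 ?(ltW t0)// -powR12_sqrt ?expR_ge0// !powe.
  rewrite mulrCA [K2 * _]mulrC -[leRHS]mulrA ler_wpM2l ?powR_ge0//.
  have -> : expR (2^-1 * lam k `^ r) =
      expR ((2^-1 - a2) * lam k `^ r) * expR (a2 * lam k `^ r).
    by rewrite -expRD; congr expR; ring.
  by rewrite mulrA ler_wpM2r ?expR_ge0.
Qed.

End error_estimate.

Theorem theorem7 (R : realType) (n : nat) (alpha beta l : R)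
    (halpha : 0 < alpha <= 1) (hbeta : 0 <= beta) (hl : 0 < l)
    (Om : set 'rV[R]_n.+1) (hOm : bounded_smooth_domain Om)
    (L : ('rV[R]_n.+1 -> R) -> ('rV[R]_n.+1 -> R))
    (hL : symmetric_uniformly_elliptic Om L)
    (lam : nat -> R) (phi : nat -> 'rV[R]_n.+1 -> R)
    (hphi : eigensystem Om L lam phi) :
  (forall r p : R, r <= 0 -> 0 < p ->
    exists2 C : R, 0 < C &
    forall (delta tau : R) (f g F Kg hd gt : 'rV[R]_n.+1 -> R),
      0 < delta ->
      noisy_trace Om lam phi alpha beta l f g F Kg hd delta ->
      exp_qbv_solution Om lam phi alpha beta l tau r (F \- hd) gt ->
      frac_dom Om lam phi p g ->
      (1 <= p -> tau = delta `^ (1 / 2) ->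
        L2_norm Om (gt \- g) <=
          C * (1 + frac_norm Om lam phi p g) * delta `^ (1 / 2)) /\
      (p < 1 -> tau = delta `^ (1 / (p + 1)) ->
        L2_norm Om (gt \- g) <=
          C * (1 + frac_norm Om lam phi p g) * delta `^ (p / (p + 1)))) /\
  (forall r p : R, 0 < r -> 1 < p ->
    exists2 C : R, 0 < C &
    forall (delta tau : R) (f g F Kg hd gt : 'rV[R]_n.+1 -> R),
      0 < delta ->
      noisy_trace Om lam phi alpha beta l f g F Kg hd delta ->
      exp_qbv_solution Om lam phi alpha beta l tau r (F \- hd) gt ->
      exp_dom Om lam phi r g ->
      tau = delta `^ ((p + 1) * (1 + r) / (p + r + 2)) ->
      L2_norm Om (gt \- g) <=
        C * (1 + exp_norm Om lam phi r g) *
        delta `^ ((1 + r) / (p + r + 2))).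
Proof.
split=> r p r0 p0; last by have := pos_rate halpha hbeta hl hOm hphi r0 p0.
(* For a given [p] one of the two clauses is vacuous. For [p >= 1] the rate is used with [a = 1],
   where both exponents equal 1/2, and otherwise with [a = p]. *)
have [p1|p1] := leP 1 p.
  have a01 : 0 < (1 : R) <= 1 by rewrite ltr01 lexx.
  have [C C0 CP] := nonpos_rate halpha hbeta hl hOm hphi r0 a01 p1.
  exists C => // delta tau f g F Kg hd gt d0 hn hs hg; split=> // _.
  exact: CP d0 hn hs hg.
have a01 : 0 < p <= 1 by rewrite p0 ltW.
have [C C0 CP] := nonpos_rate halpha hbeta hl hOm hphi r0 a01 (lexx p).
exists C => // delta tau f g F Kg hd gt d0 hn hs hg; split=> // _.
exact: CP d0 hn hs hg.
Qed.
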